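(* Let $\Omega=\bigcup_{i=1}^nJ_i$, $J_i=(\alpha_i,\beta_i)$, with $-\infty<\alpha_1<\beta_1<\alpha_2<\beta_2<\dots<\alpha_n<\beta_n<\infty$. Let $\Gamma_+$, $\Gamma_-$ be the $n\times n$ diagonal matrices with diagonal entries $(\gamma_i^+)$ and $(\gamma_i^-)$ respectively, and for $v=(v_1,\dots,v_n)$ let $E(v)$ be the diagonal matrix with entries $e^{v_1},\dots,e^{v_n}$. Write $\alpha=(\alpha_1,\dots,\alpha_n)$, $\beta=(\beta_1,\dots,\beta_n)$. The bijective correspondence between the unitaries $W:\mathcal{L}_+\to\mathcal{L}_-$ (written as matrices in the orthonormal bases of $\mathcal{L}_\pm$ given in the context) and the $n\times n$ unitary matrices $B$, under which $W$ and $B$ correspond when they define the same self-adjoint extension of $\mathsf{D}$ (that is, when $\mathcal{D}_W=\mathcal{D}_B$), is given by $$B=\left(\Gamma_-E(2\pi\beta)W+\Gamma_+E(-2\pi\beta)\right)\left(\Gamma_-E(2\pi\alpha)W+\Gamma_+E(-2\pi\alpha)\right)^{-1}.$$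
   Context: $\mathsf{D}f=\frac1{2\pi \mathrm{i}}f'$ on $C_c^\infty(\Omega)\subset L^2(\Omega)$. Its adjoint $\mathsf{D}^*$ has domain $\mathcal{D}_{\max}=\{f\in L^2(\Omega): f\text{ absolutely continuous on each }J_i,\ f'\in L^2(\Omega)\}$ and $\mathsf{D}^*f=\frac1{2\pi \mathrm{i}}f'$. For $f\in\mathcal{D}_{\max}$, $f(\alpha)=(f(\alpha_i))_{i=1}^n$ and $f(\beta)=(f(\beta_i))_{i=1}^n$ are the vectors of one-sided limits at the endpoints from inside $J_i$. $\mathcal{D}_0(\Omega)=\{f\in\mathcal{D}_{\max}: f(\alpha)=f(\beta)=0\}$. $\mathcal{L}_+=\ker(\mathsf{D}^*-\mathrm{i}I)$ and $\mathcal{L}_-=\ker(\mathsf{D}^*+\mathrm{i}I)$. With $$\gamma_i^+=\sqrt{\frac{4\pi}{e^{-4\pi\alpha_i}-e^{-4\pi\beta_i}}},\qquad\gamma_i^-=\sqrt{\frac{4\pi}{e^{4\pi\beta_i}-e^{4\pi\alpha_i}}},$$ the functions $\gamma_i^+e^{-2\pi t}\chi_{J_i}(t)$, $i=1,\dots,n$, form an orthonormal basis of $\mathcal{L}_+$ and the functions $\gamma_i^-e^{2\pi t}\chi_{J_i}(t)$, $i=1,\dots,n$, form an orthonormal basis of $\mathcal{L}_-$. The self-adjoint extensions of $\mathsf{D}$ are parametrized bijectively in two ways: by unitaries $W:\mathcal{L}_+\to\mathcal{L}_-$, the extension being $\mathsf{D}^*$ restricted to $\mathcal{D}_W=\{f+f_++Wf_+: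 f\in\mathcal{D}_0(\Omega),\ f_+\in\mathcal{L}_+\}$; and by $n\times n$ unitary matrices $B$, the extension being $\mathsf{D}^*$ restricted to $\mathcal{D}_B=\{f\in\mathcal{D}_{\max}: Bf(\alpha)=f(\beta)\}$. *)

(* Defs.v *)
From mathcomp Require Import all_boot all_order all_algebra.
From mathcomp Require Import all_classical all_reals all_analysis.
From mathcomp Require Import spectral complex.

Set Implicit Arguments.
Unset Strict Implicit.
Unset Printing Implicit Defensive.

Import Order.TTheory GRing.Theory Num.Theory.
Import numFieldNormedType.Exports.

Local Open Scope classical_set_scope.
Local Open Scope complex_scope.
Local Open Scope ring_scope.

Local Notation mu := lebesgue_measure.

Section complex_valued.
Context {R : realType}.
Implicit Types (A : set R) (f g : R -> R[i]).

(* The last clause makes this invariant under changes on Lebesgue-null sets,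
   so that Lebesgue- rather than Borel-measurability is what is required. *)
Definition square_integrable A f : Prop :=
  exists g, [/\ measurable_fun A (fun x => complex.Re (g x)),
                measurable_fun A (fun x => complex.Im (g x)),
                (\int[mu]_(x in A)
                   (complex.Re (g x) ^+ 2 + complex.Im (g x) ^+ 2)%:E < +oo)%E &
                {ae mu, forall x, A x -> f x = g x}].

(* Linear in the first argument. *)
Definition inner_product A f g : R[i] :=
  Rintegral mu A (fun x => complex.Re (f x * (g x)^*%C)) +i*
  Rintegral mu A (fun x => complex.Im (f x * (g x)^*%C)).

Definition abs_continuous_on A f : Prop :=
  forall e : R, 0 < e -> exists2 d : R, 0 < d &
    forall (m : nat) (s t : 'I_m -> R),
      (forall k, [/\ A (s k), A (t k) & s k <= t k]) ->
      (forall j k, j != k -> t j <= s k \/ t k <= s j) ->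
      \sum_(k < m) (t k - s k) < d ->
      \sum_(k < m) `|f (t k) - f (s k)| < e%:C.

Definition cderivable f (x : R) : Prop :=
  derivable (fun y => complex.Re (f y)) x 1 /\ derivable (fun y => complex.Im (f y)) x 1.

Definition cderive f (x : R) : R[i] :=
  derive1 (fun y => complex.Re (f y)) x +i*
  derive1 (fun y => complex.Im (f y)) x.

Definition lim_right f (a : R) : R[i] :=
  lim (complex.Re (f x) @[x --> a^'+]) +i* lim (complex.Im (f x) @[x --> a^'+]).

Definition lim_left f (a : R) : R[i] :=
  lim (complex.Re (f x) @[x --> a^'-]) +i* lim (complex.Im (f x) @[x --> a^'-]).

End complex_valued.

Section momentum_operator.
Context {R : realType} {n : nat}.
Variables alpha beta : 'I_n -> R.
Implicit Types (f g : R -> R[i]) (W : (R -> R[i]) -> (R -> R[i])).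

Definition J (i : 'I_n) : set R := [set` `]alpha i, beta i[].

Definition Omega : set R := \bigcup_(i in [set: 'I_n]) J i.

(* An element of the domain of D^* is a class modulo a.e. equality on Omega
   which contains exactly one function that is absolutely continuous on each
   J i and vanishes off Omega; the class is identified with that function, so
   that equality of elements of the domain is equality of functions.  The
   derivative exists only almost everywhere, and [cderive] takes irrelevant
   values at the exceptional points. *)
Definition Dmax : set (R -> R[i]) :=
  [set f | [/\ forall x, ~ Omega x -> f x = 0,
               square_integrable Omega f,
               forall i, abs_continuous_on (J i) f,
               {ae mu, forall x, Omega x -> cderivable f x} &
               square_integrable Omega (cderive f)]].

Definition Dstar f (x : R) : R[i] := ((2 * pi)%:C * 'i%C)^-1 * cderive f x.

Definition trace_alpha f : 'cV[R[i]]_n := \col_i lim_right f (alpha i).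
Definition trace_beta f : 'cV[R[i]]_n := \col_i lim_left f (beta i).

Definition D0 : set (R -> R[i]) :=
  [set f | [/\ Dmax f, trace_alpha f = 0 & trace_beta f = 0]].

Definition Lplus : set (R -> R[i]) :=
  [set f | Dmax f /\ {ae mu, forall x, Omega x -> Dstar f x - 'i%C * f x = 0}].

Definition Lminus : set (R -> R[i]) :=
  [set f | Dmax f /\ {ae mu, forall x, Omega x -> Dstar f x + 'i%C * f x = 0}].

Definition gamma_plus (i : 'I_n) : R :=
  Num.sqrt (4 * pi / (expR (- (4 * pi * alpha i)) - expR (- (4 * pi * beta i)))).

Definition gamma_minus (i : 'I_n) : R :=
  Num.sqrt (4 * pi / (expR (4 * pi * beta i) - expR (4 * pi * alpha i))).

Definition basis_plus (i : 'I_n) (t : R) : R[i] :=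
  (gamma_plus i * expR (- (2 * pi * t)) * \1_(J i) t)%:C.

Definition basis_minus (i : 'I_n) (t : R) : R[i] :=
  (gamma_minus i * expR (2 * pi * t) * \1_(J i) t)%:C.

(* Only the restriction of W to Lplus is meaningful. *)
Definition unitary_Lplus_Lminus W : Prop :=
  [/\ forall f, Lplus f -> Lminus (W f),
      forall (c : R[i]) f g, Lplus f -> Lplus g ->
        W (fun x => c * f x + g x) = (fun x => c * W f x + W g x),
      forall f g, Lplus f -> Lplus g ->
        inner_product Omega (W f) (W g) = inner_product Omega f g &
      forall g, Lminus g -> exists2 f, Lplus f & W f = g].

(* Column j holds the coordinates of the image of the j-th basis vector. *)
Definition matrix_of W : 'M[R[i]]_n :=
  \matrix_(i, j) inner_product Omega (W (basis_plus j)) (basis_minus i).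

Definition domW W : set (R -> R[i]) :=
  [set f | exists f0 fp,
    [/\ D0 f0, Lplus fp & f = (fun x => f0 x + fp x + W fp x)]].

Definition domB (B : 'M[R[i]]_n) : set (R -> R[i]) :=
  [set f | Dmax f /\ B *m trace_alpha f = trace_beta f].

Definition Gamma_plus : 'M[R[i]]_n := diag_mx (\row_i (gamma_plus i)%:C).
Definition Gamma_minus : 'M[R[i]]_n := diag_mx (\row_i (gamma_minus i)%:C).

End momentum_operator.

Definition E {R : realType} {n : nat} (v : 'I_n -> R) : 'M[R[i]]_n :=
  diag_mx (\row_i (expR (v i))%:C).

(* Main.v *)
Require Import Defs.
From mathcomp Require Import all_boot all_order all_algebra.
From mathcomp Require Import all_classical all_reals all_analysis.
From mathcomp Require Import spectral complex.
From mathcomp Require Import sesquilinear measurable_realfun ring lra.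

(* An element of a deficiency space solves f' = -2 pi f (resp. f' = 2 pi f)
   almost everywhere, so absolute continuity forces it to be a multiple of
   e^(-2 pi t) (resp. e^(2 pi t)) on each J_i.  Writing M for the matrix of W,
   an element f_0 + f_+ + W f_+ of D_W, with f_+ of coordinates c, therefore has
   boundary values f(alpha) = den(M) c and f(beta) = num(M) c; conversely every
   f in D_max with such boundary values lies in D_W, so D_W = D_B means
   B den(M) = num(M).
   With P = Gamma_- E(2 pi beta) = Gamma_+ E(-2 pi alpha) and
   Q = Gamma_- E(2 pi alpha) = Gamma_+ E(-2 pi beta) one has den(M) = Q M + P,
   num(M) = P M + Q and P^2 - Q^2 = 4 pi, so that num(M)^* num(M) =
   den(M)^* den(M) for M unitary; this makes den(M) invertible and
   num(M) den(M)^-1 unitary, and the same computation applies to the inverse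
   map B |-> (P - B Q)^-1 (B P - Q). *)

Set Implicit Arguments.
Unset Strict Implicit.
Unset Printing Implicit Defensive.

Import Order.TTheory GRing.Theory Num.Theory.
Import numFieldNormedType.Exports.

Local Open Scope classical_set_scope.
Local Open Scope complex_scope.
Local Open Scope ring_scope.
Local Open Scope sesquilinear_scope.

Local Notation mu := lebesgue_measure.

(** * Absolutely continuous functions *)

Section absolute_continuity.
Context {R : realType}.
Implicit Types (A : set R) (u h : R -> R) (l : seq (R * R)).

Definition nonoverlapping (p q : R * R) := (p.2 <= q.1) || (q.2 <= p.1).

(* Families indexed by ['I_m] are replaced by sequences, so that a partition can
   be extended by consing an interval. *)
Definition ac A h := forall e : R, 0 < e -> exists2 d : R, 0 < d &
  forall l, (forall p, p \in l -> [/\ A p.1, A p.2 & p.1 <= p.2]) ->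
    pairwise nonoverlapping l ->
    \sum_(p <- l) (p.2 - p.1) < d -> \sum_(p <- l) `|h p.2 - h p.1| < e.

Lemma ac_sub A B h : A `<=` B -> ac B h -> ac A h.
Proof.
move=> AB ach e e0; have [d d0 Hd] := ach e e0; exists d => // l lA.
by apply: Hd => p /lA[? ? ?]; split => //; exact: AB.
Qed.

(** The term [t - s] lets one criterion cover scalar multiples, products with an exponential and,
    for [u = 0], Lipschitz functions. *)
Lemma ac_dominated A u h (C : R) : ac A u ->
  (forall s t, A s -> A t -> s <= t ->
     `|h t - h s| <= C * (`|u t - u s| + (t - s))) -> ac A h.
Proof.
move=> acu hu e e0.
pose C1 := `|C| + 1; have C10 : 0 < C1 by rewrite ltr_wpDl.
have e2 : 0 < e / (2 * C1) by rewrite divr_gt0 // mulr_gt0.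
have [d d0 Hd] := acu _ e2.
exists (Num.min d (e / (2 * C1))); first by rewrite lt_min d0 e2.
move=> l lA pl; rewrite lt_min => /andP[ld le].
have {Hd}ue := Hd l lA pl ld.
apply: (@le_lt_trans _ _ (C1 * (\sum_(p <- l) `|u p.2 - u p.1| +
                                \sum_(p <- l) (p.2 - p.1)))).
  rewrite -big_split /= mulr_sumr big_seq [leRHS]big_seq; apply: ler_sum => p pl'.
  have [? ? ?] := lA _ pl'.
  apply: le_trans (hu _ _ _ _ _) _ => //; apply: ler_wpM2r.
    by rewrite addr_ge0 // subr_ge0.
  by rewrite /C1 (le_trans (ler_norm C)) // lerDl.
rewrite mulrC -ltr_pdivlMr //.
have -> : e / C1 = e / (2 * C1) + e / (2 * C1) by field; rewrite gt_eqF.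
exact: ltrD.
Qed.

(** Absolute continuity tested on a family of one interval. *)
Lemma ac_uniform A h : ac A h -> forall e : R, 0 < e -> exists2 d : R, 0 < d &
  forall s t, A s -> A t -> `|t - s| < d -> `|h t - h s| < e.
Proof.
move=> ach e e0; have [d d0 Hd] := ach e e0; exists d => // s t As At.
wlog st : s t As At / s <= t => [hw|].
  have [st|ts] := leP s t; first exact: hw.
  by rewrite distrC => /hw -/(_ At As (ltW ts)); rewrite distrC.
rewrite ger0_norm ?subr_ge0 // => tsd.
have := Hd [:: (s, t)]; rewrite !big_seq1 /=; apply => //.
by move=> p; rewrite inE => /eqP ->.
Qed.

Lemma is_derive0_le h (x e : R) : is_derive x 1 h 0 -> 0 < e ->
  exists2 d : R, 0 < d &
    forall y, `|y - x| < d -> `|h y - h x| <= e * `|y - x|.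
Proof.
move=> [dh h0] e0.
have : (fun k : R => k^-1 *: (h (k *: 1 + x) - h x)) @ 0^' --> (0 : R).
  by rewrite -[X in _ --> X]h0; exact: dh.
move/cvgr0Pnorm_lt => /(_ e e0).
rewrite near_withinE => /nbhs_ballP[d /= d0 Hd].
exists d => // y yd.
have [->|yx] := eqVneq y x; first by rewrite !subrr normr0 mulr0.
have /= := Hd (y - x); rewrite /ball /= sub0r normrN => /(_ yd).
rewrite subr_eq0 => /(_ yx).
rewrite /GRing.scale /= mulr1 subrK normrM normfV mulrC.
by rewrite ltr_pdivrMr ?normr_gt0 ?subr_eq0 // => /ltW.
Qed.

(** Additivity of the measure. The growth of mu (U [&] [a, x]) in [x] will pay for the lengths of
    the exceptional intervals. *)
Lemma measure_segment_le (U : set R) (a x y : R) : measurable U -> (mu U < +oo)%E ->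
  x <= y -> a <= x -> `[x, y] `<=` U ->
  fine (mu (U `&` `[a, x])) + (y - x) <= fine (mu (U `&` `[a, y])).
Proof.
move=> mU Uoo xy ax xyU.
have fin z : mu (U `&` `[a, z]) \is a fin_num.
  rewrite ge0_fin_numE //; apply: le_lt_trans Uoo.
  by apply: le_measure; rewrite ?inE //; exact: measurableI.
rewrite -lee_fin EFinD !fineK //.
have -> : (y - x)%:E = mu `]x, y].
  rewrite lebesgue_measure_itv /= lte_fin.
  by move: xy; rewrite le_eqVlt => /predU1P[->|->] //; rewrite ltxx subrr.
rewrite -measureU //; last 2 first.
- exact: measurableI.
- apply/seteqP; split => // z [[_]] /=; rewrite !in_itv /= => /andP[_ zx].
  by rewrite ltNge zx.
apply: le_measure; rewrite ?inE; [|exact: measurableI|].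
  by apply: measurableU => //; exact: measurableI.
move=> z [[Uz]|] /=; rewrite !in_itv /= => /andP[az zx].
  by split => //; rewrite az (le_trans zx).
split; first by apply: xyU; rewrite /= in_itv /= (ltW az).
by rewrite zx (le_trans ax) // ltW.
Qed.


Lemma ae_open_cover (P : set R) (d : R) : {ae mu, forall x, P x} -> 0 < d ->
  exists U : set R, [/\ open U, ~` P `<=` U & (mu U < d%:E)%E].
Proof.
move=> [N [mN N0 PN]] d0.
have [|U [oU NU Ud]] := lebesgue_regularity_outer mN _ d0.
  by rewrite [X in (X < _)%E]N0 ltry.
exists U; split => //; first exact: subset_trans NU.
have mU : measurable U by exact: open_measurable.
(* Outer regularity bounds only the measure of U minus N; the null set [N] is added back by
   subadditivity. *)
have -> : U = (U `\` N) `|` N by rewrite setUC setDUK.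
apply: le_lt_trans Ud; rewrite -[leRHS]adde0 -N0.
by apply: measureU2 => //; exact: measurableD.
Qed.

(* Cousin-style argument, which dispenses with Vitali's covering theorem: off
   the null set the increments of [h] are at most [e] times the length, while
   the exceptional points are handled by intervals lying in an open set of
   small measure, on which absolute continuity applies. *)
Lemma ac_derive0_constant h (a b : R) : a <= b -> ac `[a, b] h ->
  {ae mu, forall x, x \in `[a, b] -> is_derive x 1 h 0} -> h a = h b.
Proof.
move=> ab ach dh.
suff le_e e : 0 < e -> `|h b - h a| <= e * (b - a) + e.
  apply/eqP; rewrite eq_sym -subr_eq0 -normr_le0; apply/ler_addgt0Pr => e e0.
  rewrite add0r; have k0 : 0 < b - a + 1 by rewrite ltr_wpDl // subr_ge0.
  have := le_e (e / (b - a + 1)); rewrite divr_gt0 // => /(_ isT).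
  by rewrite -[X in _ <= _ + X]mulr1 -mulrDr divfK // gt_eqF.
move=> e0; have [d d0 Hd] := ach e e0.
have [U [oU NU Ud]] := ae_open_cover dh d0.
have mU : measurable U by exact: open_measurable.
have Uoo : (mu U < +oo)%E by exact: lt_trans Ud (ltry _).
pose m x := fine (mu (U `&` `[a, x])).
(* The points reached from [a] with slope at most [e], up to the increments of [h] over a family of
   intervals whose total length stays within the budget [m x]. *)
pose S := [set x | a <= x <= b /\ exists l, [/\
  forall p, p \in l -> [/\ a <= p.1, p.2 <= x & p.1 <= p.2],
  pairwise nonoverlapping l, \sum_(p <- l) (p.2 - p.1) <= m x &
  `|h x - h a| <= e * (x - a) + \sum_(p <- l) `|h p.2 - h p.1|]].
have Sa : S a.
  split; first by rewrite lexx.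
  by exists [::]; split; rewrite ?big_nil ?subrr ?mulr0 ?addr0 ?normr0 ?fine_ge0.
have fin_m x : mu (U `&` `[a, x]) \is a fin_num.
  rewrite ge0_fin_numE //; apply: le_lt_trans Uoo.
  by apply: le_measure; rewrite ?inE //; exact: measurableI.
have m_mono x y : x <= y -> m x <= m y.
  move=> xy; apply: fine_le => //.
  apply: le_measure; rewrite ?inE; [exact: measurableI|exact: measurableI|].
  by move=> z [Uz] /=; rewrite !in_itv /= => /andP[-> zx]; rewrite (le_trans zx).
(* Near every [c], membership in [S] passes from a point on the left of [c] to any point on its
   right. *)
have step c : a <= c <= b -> exists2 r : R, 0 < r &
    forall x y, S x -> x <= c <= y -> y <= b -> c - r < x -> y < c + r -> S y.
  move=> /andP[ac_ cb].
  have [Uc|nUc] := pselect (U c).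
    have /nbhs_ballP[r /= r0 rU] : nbhs c U by exact: open_nbhs_nbhs.
    exists r => // x y [/andP[ax xb] [l [la pl lm hl]]] /andP[xc cy] yb cx yc.
    have xy := le_trans xc cy.
    split; first by rewrite (le_trans ax xy).
    (* At an exceptional point [x, y] lies in [U]: it joins the family, and its length is covered by
       the growth of [m]. *)
    exists ((x, y) :: l); split.
    - move=> p; rewrite inE => /predU1P[->//|/la[? px ?]].
      by split => //; exact: le_trans px xy.
    - rewrite pairwise_cons pl andbT; apply/allP => p /la[_ px _].
      by rewrite /nonoverlapping /= px orbT.
    - rewrite big_cons /= addrC.
      apply: le_trans (measure_segment_le mU Uoo xy ax _); first by rewrite lerD2r.
      move=> z /=; rewrite in_itv /= => /andP[xz zy]; apply: rU.
      rewrite /ball /= ltr_norml; apply/andP; split; lra.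
    - rewrite big_cons /=.
      have := ler_normD (h y - h x) (h x - h a); rewrite addrA subrK => H.
      apply: le_trans H _.
      have : e * (x - a) <= e * (y - a) by apply: ler_wpM2l; [exact: ltW|lra].
      move: hl; set t := \sum_(_ <- _) _; lra.
  (* Off [U] the derivative at [c] is 0, so the increments from [x] to [c] and from [c] to [y] have
     slope at most [e] and the family is unchanged. *)
  have dc : is_derive c 1 h 0.
    apply: contrapT => nd; apply/nUc/NU => /= H.
    by apply/nd/H; rewrite in_itv /= ac_.
  have [r r0 Hr] := is_derive0_le dc e0.
  exists r => // x y [/andP[ax xb] [l [la pl lm hl]]] /andP[xc cy] yb cx yc.
  have xy := le_trans xc cy.
  split; first by rewrite (le_trans ax xy).
  exists l; split => //.
  - by move=> p /la[? px ?]; split => //; exact: le_trans px xy.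
  - exact: le_trans lm (m_mono _ _ xy).
  have := ler_normD (h y - h x) (h x - h a); rewrite addrA subrK => H.
  apply: le_trans H _.
  have hx := Hr x; have hy := Hr y.
  have := ler_normD (h y - h c) (h c - h x); rewrite addrA subrK (distrC (h c)) => H.
  move: hx hy; rewrite [`|x - c|]distrC.
  rewrite (ger0_norm (_ : 0 <= c - x)) ?subr_ge0 //.
  rewrite (ger0_norm (_ : 0 <= y - c)) ?subr_ge0 //.
  move=> hx hy.
  have {}hx : `|h x - h c| <= e * (c - x) by apply: hx; lra.
  have {}hy : `|h y - h c| <= e * (y - c) by apply: hy; lra.
  move: hl; set t := \sum_(_ <- _) _; lra.
have supS : has_sup S.
  by split; [exists a | exists b => x [/andP[]]].
set c := sup S.
have acb : a <= c <= b.
  rewrite sup_upper_bound //=; apply: sup_le_ub => //; first by exists a.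
  by move=> x [/andP[]].
have [r r0 Hr] := step c acb.
have [x Sx cx] := sup_adherent r0 supS.
have xc : x <= c by exact: sup_upper_bound.
(* Otherwise the step at [c] would put the minimum of [b] and [c + r / 2] in [S], beyond its
   supremum. *)
have cb : c = b.
  apply/eqP; rewrite eq_le (andP acb).2 leNgt; apply/negP => cb.
  have : S (Num.min b (c + r / 2)).
    have r2 : 0 < r / 2 by rewrite divr_gt0.
    apply: Hr Sx _ _ cx _.
    - by rewrite xc le_min (ltW cb) lerDl ltW.
    - by rewrite ge_min lexx.
    - by rewrite gt_min; apply/orP; right; lra.
  move=> /(sup_upper_bound supS); rewrite -/c leNgt lt_min cb /=.
  by rewrite ltrDl divr_gt0.
have [_ [l [la pl lm hl]]] : S b.
  by apply: Hr Sx _ _ cx _; rewrite ?xc ?cb ?lexx // ltrDl.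
(* The family reaching [b] has total length at most [m b], hence less than [d], so absolute
   continuity bounds its increments by [e]. *)
apply: le_trans hl _; rewrite lerD2l ltW //; apply: Hd => //.
  move=> p /la[ap pb pp]; split => //; rewrite /= in_itv /=; apply/andP; split => //.
  - exact: le_trans pp pb.
  - exact: le_trans ap pp.
apply: le_lt_trans lm _; rewrite -lte_fin fineK //; apply: le_lt_trans Ud.
by apply: le_measure; rewrite ?inE //; exact: measurableI.
Qed.

End absolute_continuity.

(** * First-order linear equations and one-sided limits on an interval *)

Section ac_interval.
Context {R : realType}.
Implicit Types (u h : R -> R).

Lemma ae_imply (A B : set R) : (forall x, A x -> B x) ->
  {ae mu, forall x, A x} -> {ae mu, forall x, B x}.
Proof. exact: (@filterS _ _ (ae_filter_ringOfSetsType lebesgue_measure)). Qed.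

Lemma ae_and (A B : set R) :
  {ae mu, forall x, A x} -> {ae mu, forall x, B x} ->
  {ae mu, forall x, A x /\ B x}.
Proof. exact: (@filterI _ _ (ae_filter_ringOfSetsType lebesgue_measure)). Qed.

(** For q <= p, multiply e^(q - p) >= 1 + (q - p) by e^p and bound e^p by e^B. *)
Lemma expR_lipschitz (B p q : R) : p <= B -> q <= B ->
  `|expR p - expR q| <= expR B * `|p - q|.
Proof.
wlog pq : p q / q <= p => [hw pB qB|].
  have [qp|/ltW pq] := leP q p; first exact: hw.
  by rewrite distrC [`|p - q|]distrC; exact: hw.
move=> pB _; rewrite !ger0_norm ?subr_ge0 ?ler_expR //.
have := expR_ge1Dx (q - p); rewrite -(ler_pM2l (expR_gt0 p)) -expRD subrKC => H.
apply: (@le_trans _ _ (expR p * (p - q))); first lra.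
by apply: ler_wpM2r; rewrite ?subr_ge0 ?ler_expR.
Qed.

(** A bound on the exponent whatever the sign of [k], to be used as the [B] of [expR_lipschitz]. *)
Lemma itv_mulr_le (k a b t : R) : a <= t <= b -> k * t <= `|k| * (`|a| + `|b|).
Proof.
move=> /andP[at_ tb]; apply: le_trans (ler_norm _) _; rewrite normrM ler_wpM2l //.
rewrite ler_norml; apply/andP; split.
  by apply: le_trans _ at_; rewrite lerNl (le_trans (ler_norm _)) // normrN lerDl.
by apply: (le_trans tb); rewrite (le_trans (ler_norm _)) // lerDr.
Qed.

Lemma ac_continuous (a b : R) u : ac `]a, b[ u -> {in `]a, b[, continuous u}.
Proof.
move=> /ac_uniform acu x xab; apply/cvgrPdist_lt => e e0.
have [d d0 Hd] := acu e e0.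
near=> t; apply: Hd.
- by near: t; exact: near_in_itvoo.
- by [].
- by near: t; apply/nbhs_ballP; exists d.
Unshelve. all: by end_near. Qed.

(** On the compact interval [x, y] the continuous function [u] is bounded and the exponential is
    bounded and Lipschitz, so the product rule for increments gives the domination. *)
Lemma ac_mul_expR (a b x y k : R) u : ac `]a, b[ u -> a < x -> x <= y -> y < b ->
  ac `[x, y] (fun t => u t * expR (k * t)).
Proof.
move=> acu ax xy yb.
have sub : `[x, y] `<=` `]a, b[.
  move=> t /=; rewrite !in_itv /= => /andP[xt ty].
  by rewrite (lt_le_trans ax) //= (le_lt_trans ty).
have [c cxy Mc] : exists2 c, c \in `[x, y] & forall t, t \in `[x, y] -> `|u t| <= `|u c|.
  apply: (@EVT_max R (fun t => `|u t|)) => //.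
  apply: continuous_in_subspaceT => t txy; apply: cvg_norm.
  apply: (ac_continuous acu); move: txy; rewrite inE; exact: sub.
set M := `|u c| in Mc.
pose B := expR (`|k| * (`|x| + `|y|)).
have B0 : 0 < B by exact: expR_gt0.
apply: (@ac_dominated _ _ u _ (B + M * B * `|k|)); first exact: ac_sub sub acu.
move=> s t sA tA st.
have -> : u t * expR (k * t) - u s * expR (k * s) =
  (u t - u s) * expR (k * t) + u s * (expR (k * t) - expR (k * s)) by ring.
apply: le_trans (ler_normD _ _) _; rewrite !normrM (ger0_norm (expR_ge0 _)).
have kB z : z \in `[x, y] -> k * z <= `|k| * (`|x| + `|y|).
  by rewrite in_itv /=; exact: itv_mulr_le.
have h1 : `|u t - u s| * expR (k * t) <= B * `|u t - u s|.
  by rewrite mulrC ler_wpM2r // ler_expR kB.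
have h2 : `|u s| * `|expR (k * t) - expR (k * s)| <= M * (B * (`|k| * (t - s))).
  apply: ler_pM => //; first exact: Mc.
  apply: le_trans (expR_lipschitz (kB _ tA) (kB _ sA)) _.
  rewrite -mulrBr normrM [X in _ * (_ * X)]ger0_norm ?subr_ge0 //.
apply: le_trans (lerD h1 h2) _.
have M0 : 0 <= M by exact: normr_ge0.
have := mulr_ge0 (ltW B0) (_ : 0 <= t - s); rewrite subr_ge0 => /(_ st).
have : 0 <= M * B * `|k| * `|u t - u s| by rewrite !mulr_ge0 // ltW.
nra.
Qed.

Lemma is_derive_expRM (k z : R) :
  is_derive z 1 (fun t => expR (k * t)) (k * expR (k * z)).
Proof.
by apply: is_derive_eq; rewrite ?scaler0 ?add0r /GRing.scale /= ?mulr1 ?mul1r mulrC.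
Qed.

Lemma continuous_expRM (k : R) : continuous (fun t : R => expR (k * t)).
Proof.
move=> z; apply: differentiable_continuous; apply/derivable1_diffP.
by case: (is_derive_expRM k z).
Qed.

(** Integrating factor: u(t) e^(-k t) is absolutely continuous on compact subintervals with
    derivative 0 almost everywhere, hence constant. *)
Lemma ac_ode (a b k : R) u : ac `]a, b[ u ->
  {ae mu, forall x, x \in `]a, b[ -> is_derive x 1 u (k * u x)} ->
  exists c, forall x, x \in `]a, b[ -> u x = c * expR (k * x).
Proof.
move=> acu du.
pose w t := u t * expR (- k * t).
have ww x y : a < x -> x <= y -> y < b -> w x = w y.
  move=> ax xy yb; apply: ac_derive0_constant => //; first exact: ac_mul_expR acu ax xy yb.
  move: du; apply: ae_imply => z + zxy.
  have zab : z \in `]a, b[.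
    move: zxy; rewrite !in_itv /= => /andP[xz zy].
    by rewrite (lt_le_trans ax) //= (le_lt_trans zy).
  move=> /(_ zab) uz.
  have := is_deriveM uz (is_derive_expRM (- k) z) => H; apply: is_derive_eq H _.
  by rewrite /GRing.scale /=; ring.
have uw x : u x = w x * expR (k * x).
  by rewrite /w -mulrA -expRD mulNr addNr expR0 mulr1.
have [ab|ba] := ltP a b; last first.
  by exists 0 => x; rewrite in_itv /= => /andP[ax /(lt_trans ax)]; rewrite ltNge ba.
(* The constant is read off at the midpoint, which lies in the interval. *)
exists (w ((a + b) / 2)) => x; rewrite in_itv /= => /andP[ax xb].
rewrite uw; congr (_ * _).
have [?|/ltW ?] := leP x ((a + b) / 2); first by apply: ww; lra.
by apply/esym/ww; lra.
Qed.

Lemma ac_cvg_right (a b : R) u : a < b -> ac `]a, b[ u -> cvg (u x @[x --> a^'+]).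
Proof.
move=> ab /ac_uniform acu; apply/cauchy_cvgP/cauchyP => e e0.
have [d d0 Hd] := acu e e0.
(* The sample point lies inside the interval and within [d] of every point close enough to [a] on
   its right, so uniform continuity makes the image filter Cauchy. *)
exists (u (a + Num.min d (b - a) / 2)).
change (\forall x \near a^'+, ball (u (a + Num.min d (b - a) / 2)) e (u x)).
have m0 : 0 < Num.min d (b - a) by rewrite lt_min d0 subr_gt0.
have md : Num.min d (b - a) <= d by rewrite ge_min lexx.
have mb : Num.min d (b - a) <= b - a by rewrite ge_min lexx orbT.
set m := Num.min d (b - a) in m0 md mb *.
near=> x.
have xa : a < x by near: x; exact: nbhs_right_gt.
have xm : x < a + m by near: x; apply: nbhs_right_lt; rewrite ltrDl.
apply: Hd; rewrite /= ?in_itv /=.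
- by apply/andP; split; lra.
- by apply/andP; split; lra.
- by rewrite ltr_norml; apply/andP; split; lra.
Unshelve. all: by end_near. Qed.

Lemma ac_cvg_left (a b : R) u : a < b -> ac `]a, b[ u -> cvg (u x @[x --> b^'-]).
Proof.
move=> ab /ac_uniform acu; apply/cauchy_cvgP/cauchyP => e e0.
have [d d0 Hd] := acu e e0.
exists (u (b - Num.min d (b - a) / 2)).
change (\forall x \near b^'-, ball (u (b - Num.min d (b - a) / 2)) e (u x)).
have m0 : 0 < Num.min d (b - a) by rewrite lt_min d0 subr_gt0.
have md : Num.min d (b - a) <= d by rewrite ge_min lexx.
have mb : Num.min d (b - a) <= b - a by rewrite ge_min lexx orbT.
set m := Num.min d (b - a) in m0 md mb *.
near=> x.
have xa : x < b by near: x; exact: nbhs_left_lt.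
have xm : b - m < x by near: x; apply: nbhs_left_gt; rewrite ltrBlDr ltrDl.
apply: Hd; rewrite /= ?in_itv /=.
- by apply/andP; split; lra.
- by apply/andP; split; lra.
- by rewrite ltr_norml; apply/andP; split; lra.
Unshelve. all: by end_near. Qed.

End ac_interval.

(** * Absolute continuity and square integrability of complex-valued functions *)

Section complex_ac.
Context {R : realType}.
Implicit Types (A : set R) (u v : R -> R) (f g : R -> R[i]).
Local Notation Re := complex.Re.
Local Notation Im := complex.Im.

Lemma acD A u v : ac A u -> ac A v -> ac A (u \+ v).
Proof.
move=> acu acv e e0; have e2 : 0 < e / 2 by rewrite divr_gt0.
have [d d0 Hd] := acu _ e2; have [d' d'0 Hd'] := acv _ e2.
exists (Num.min d d'); first by rewrite lt_min d0.
move=> l lA pl; rewrite lt_min => /andP[ld ld'].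
rewrite (splitr e); apply: le_lt_trans (ltrD (Hd l lA pl ld) (Hd' l lA pl ld')).
rewrite -big_split /=; apply: ler_sum => p _.
by rewrite opprD addrACA; exact: ler_normD.
Qed.

Lemma acZ A u (k : R) : ac A u -> ac A (fun x => k * u x).
Proof.
move=> acu; apply: (ac_dominated (C := `|k|) acu) => s t _ _ st.
by rewrite -mulrBr normrM ler_wpM2l // lerDl subr_ge0.
Qed.

Lemma normc_ReIm (z : R[i]) : `|z| = (Normc.normc z)%:C.
Proof. by []. Qed.

Lemma Re_le_normc (z : R[i]) : `|Re z| <= Normc.normc z.
Proof. by rewrite -lecR -normc_ReIm normc_ge_Re. Qed.

Lemma Im_le_normc (z : R[i]) : `|Im z| <= Normc.normc z.
Proof.
case: z => x y /=; rewrite -sqrtr_sqr ler_wsqrtr // lerDr sqr_ge0 //.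
Qed.

Lemma normc_le_ReIm (z : R[i]) : Normc.normc z <= `|Re z| + `|Im z|.
Proof.
case: z => x y /=; rewrite -[leRHS]ger0_norm ?addr_ge0 // -sqrtr_sqr.
rewrite ler_wsqrtr // sqrrD !real_normK ?num_real // addrAC lerDl.
by rewrite mulrn_wge0 // mulr_ge0.
Qed.

(** [Re] and [Im] are additive and bounded by the modulus, which is at most |Re| + |Im|. The proof
    also trades families indexed by ordinals for sequences. *)
Lemma abs_continuous_onP A f :
  abs_continuous_on A f <->
  ac A (fun x => Re (f x)) /\ ac A (fun x => Im (f x)).
Proof.
split=> [acf|[acr aci] e e0].
  suff H (p : R[i] -> R) : {morph p : x y / x - y} ->
      (forall z, `|p z| <= Normc.normc z) -> ac A (p \o f).
    by split; apply: H; [case=> ? ? [] | exact: Re_le_normc | case=> ? ? [] |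
                         exact: Im_le_normc].
  move=> pB pn e e0; have [d d0 Hd] := acf e e0; exists d => // l lA pl ld.
  have := Hd (size l) (fun k => (nth (0, 0) l k).1) (fun k => (nth (0, 0) l k).2).
  have -> : \sum_(k < size l) ((nth (0, 0) l k).2 - (nth (0, 0) l k).1) =
      \sum_(q <- l) (q.2 - q.1) by rewrite (big_nth (0, 0)) big_mkord.
  move=> /(_ _ _ ld) H.
  apply: (@le_lt_trans _ _ (\sum_(q <- l) Normc.normc (f q.2 - f q.1))).
    by apply: ler_sum => q _; rewrite /= -pB.
  rewrite -ltcR rmorph_sum /= (big_nth (0, 0)) big_mkord; apply: H.
    by move=> k; apply: lA; rewrite mem_nth.
  move=> j k; rewrite neq_ltn => /orP[] jk.
    move/pairwiseP : pl => /(_ (0, 0) j k); rewrite !inE => /(_ (ltn_ord _) (ltn_ord _) jk).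
    by move=> /orP[] ?; [left|right].
  move/pairwiseP : pl => /(_ (0, 0) k j); rewrite !inE => /(_ (ltn_ord _) (ltn_ord _) jk).
  by move=> /orP[] ?; [right|left].
have e2 : 0 < e / 2 by rewrite divr_gt0.
have [d d0 Hd] := acr _ e2; have [d' d'0 Hd'] := aci _ e2.
exists (Num.min d d'); first by rewrite lt_min d0.
move=> m s t stA st.
pose l := [seq (s k, t k) | k <- enum 'I_m].
have El (F : R * R -> R) : \sum_(k < m) F (s k, t k) = \sum_(q <- l) F q.
  by rewrite big_map big_enum.
rewrite (El (fun q => q.2 - q.1)) lt_min => /andP[ld ld'].
have lA q : q \in l -> [/\ A q.1, A q.2 & q.1 <= q.2].
  by move=> /mapP[k _ ->]; exact: stA.
have pl : pairwise nonoverlapping l.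
  rewrite pairwise_map; have := enum_uniq 'I_m; rewrite uniq_pairwise.
  by apply: sub_pairwise => j k /= /st[] H; rewrite /nonoverlapping /= H ?orbT.
have {}Hd := Hd l lA pl ld; have {}Hd' := Hd' l lA pl ld'.
rewrite (eq_bigr (fun k => (Normc.normc (f (t k) - f (s k)))%:C)) //.
rewrite -rmorph_sum ltcR (El (fun q => Normc.normc (f q.2 - f q.1))).
rewrite (splitr e); apply: le_lt_trans (ltrD Hd Hd').
rewrite -big_split /=; apply: ler_sum => q _.
apply: le_trans (normc_le_ReIm _) _.
by case: (f q.2) (f q.1) => ? ? [? ?].
Qed.

Lemma Re_mul_real (z : R[i]) (r : R) : Re (z * r%:C) = Re z * r.
Proof. by case: z => a b; rewrite /GRing.mul /= mulr0 subr0. Qed.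

Lemma Im_mul_real (z : R[i]) (r : R) : Im (z * r%:C) = Im z * r.
Proof. by case: z => a b; rewrite /GRing.mul /= mulr0 add0r. Qed.

Lemma conjc_mul_real (z : R[i]) (r : R) : (z * r%:C)^*%C = z^*%C * r%:C.
Proof. by case: z => a b; rewrite /GRing.mul /= !mulr0 !subr0 !add0r mulNr. Qed.

Lemma Re_lin (c x y : R[i]) : Re (c * x + y) = Re c * Re x - Im c * Im x + Re y.
Proof. by case: c x y => ? ? [? ?] []. Qed.

Lemma Im_lin (c x y : R[i]) : Im (c * x + y) = Re c * Im x + Im c * Re x + Im y.
Proof. by case: c x y => ? ? [? ?] []. Qed.

Lemma abs_continuous_on_lin A (c : R[i]) f g :
  abs_continuous_on A f -> abs_continuous_on A g ->
  abs_continuous_on A (fun x => c * f x + g x).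
Proof.
move=> /abs_continuous_onP[fr fi] /abs_continuous_onP[gr gi].
apply/abs_continuous_onP; split.
- under eq_fun do rewrite Re_lin -mulNr.
  exact: acD (acD (acZ _ fr) (acZ _ fi)) gr.
- under eq_fun do rewrite Im_lin.
  exact: acD (acD (acZ _ fi) (acZ _ fr)) gi.
Qed.

Lemma cderivable_lin (c : R[i]) f g x : cderivable f x -> cderivable g x ->
  cderivable (fun x => c * f x + g x) x /\
  cderive (fun x => c * f x + g x) x = c * cderive f x + cderive g x.
Proof.
move=> [fr fi] [gr gi]; rewrite /cderivable /cderive.
have -> : (fun y => Re (c * f y + g y)) =
   (Re c *: (fun y => Re (f y)) - Im c *: (fun y => Im (f y)) + (fun y => Re (g y))).
  by apply/funext => y; rewrite Re_lin.
have -> : (fun y => Im (c * f y + g y)) =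
   (Re c *: (fun y => Im (f y)) + Im c *: (fun y => Re (f y)) + (fun y => Im (g y))).
  by apply/funext => y; rewrite Im_lin.
have H1 := is_deriveD (is_deriveB (is_deriveZ (Re c) (derivableP fr))
  (is_deriveZ (Im c) (derivableP fi))) (derivableP gr).
have H2 := is_deriveD (is_deriveD (is_deriveZ (Re c) (derivableP fi))
  (is_deriveZ (Im c) (derivableP fr))) (derivableP gi).
case: H1 => d1 e1; case: H2 => d2 e2; split; first by split.
rewrite !derive1E [X in X +i* _ = _]e1 [X in _ +i* X = _]e2.
by clear d1 e1 d2 e2; case: c.
Qed.

Lemma square_integrable_lin A (c : R[i]) f g : measurable A ->
  square_integrable A f -> square_integrable A g ->
  square_integrable A (fun x => c * f x + g x).
Proof.
move=> mA [f' [fr fi foo ff']] [g' [gr gi goo gg']].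
have mN (h : R -> R[i]) : measurable_fun A (fun x => Re (h x)) ->
    measurable_fun A (fun x => Im (h x)) ->
    measurable_fun A (fun x => (Re (h x) ^+ 2 + Im (h x) ^+ 2)%:E).
  by move=> hr hi; apply/measurable_EFinP; apply: measurable_funD; exact: measurable_funX.
have N0 (h : R -> R[i]) x : (0 <= (Re (h x) ^+ 2 + Im (h x) ^+ 2)%:E)%E.
  by rewrite lee_fin addr_ge0 ?sqr_ge0.
have mr : measurable_fun A (fun x => Re (c * f' x + g' x)).
  under eq_fun do rewrite Re_lin.
  by apply: measurable_funD => //; apply: measurable_funB; exact: measurable_funM.
have mi : measurable_fun A (fun x => Im (c * f' x + g' x)).
  under eq_fun do rewrite Im_lin.
  by apply: measurable_funD => //; apply: measurable_funD; exact: measurable_funM.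
exists (fun x => c * f' x + g' x); split => //; last first.
  by move: (ae_and ff' gg'); apply: ae_imply => x [fx gx] Ax; rewrite fx ?gx.
(* The bound used is |c f + g|^2 <= 2 |c|^2 |f|^2 + 2 |g|^2, whose two sides differ by |c f -
   g|^2. *)
pose C := 2 * (Re c ^+ 2 + Im c ^+ 2).
have C0 : (0 <= C%:E)%E by rewrite lee_fin mulr_ge0 ?addr_ge0 ?sqr_ge0.
apply: (@le_lt_trans _ _ (\int[mu]_(x in A)
    (C%:E * (Re (f' x) ^+ 2 + Im (f' x) ^+ 2)%:E +
     2%:E * (Re (g' x) ^+ 2 + Im (g' x) ^+ 2)%:E))%E).
  apply: ge0_le_integral => //.
  - by move=> x _; exact: (N0 (fun x => c * f' x + g' x)).
  - exact: (mN (fun x => c * f' x + g' x)).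
  - by apply: emeasurable_funD; apply: measurable_funeM; exact: mN.
  - move=> x _; rewrite -!EFinM -EFinD lee_fin Re_lin Im_lin /C.
    set a := Re c; set b := Im c; set p := Re _; set q := Im (f' x).
    set r := Re _; set s := Im _.
    have := sqr_ge0 (a * p - b * q - r); have := sqr_ge0 (a * q + b * p - s); nra.
rewrite ge0_integralD //.
- rewrite !ge0_integralZl //; try exact: mN.
  by apply: lte_add_pinfty; apply: lte_mul_pinfty.
- by move=> x _; rewrite mule_ge0 ?N0.
- by apply: measurable_funeM; exact: mN.
- by move=> x _; rewrite mule_ge0 ?N0.
- by apply: measurable_funeM; exact: mN.
Qed.

End complex_ac.

(** * Functions on a union of intervals *)

Section limits.
Context {R : realType}.
Implicit Types (f g : R -> R[i]).
Local Notation Re := complex.Re.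
Local Notation Im := complex.Im.

(** Convertible to [lim_right] and [lim_left] for the two one-sided filters, so that facts about
    both traces have one proof. *)
Definition clim (F : set_system R) f : R[i] :=
  lim (Re (f x) @[x --> F]) +i* lim (Im (f x) @[x --> F]).

Definition ccvg (F : set_system R) f :=
  cvg (Re (f x) @[x --> F]) /\ cvg (Im (f x) @[x --> F]).

Lemma clim_lin (F : set_system R) (c : R[i]) f g : ProperFilter F ->
  ccvg F f -> ccvg F g -> clim F (fun x => c * f x + g x) = c * clim F f + clim F g.
Proof.
move=> FF [fr fi] [gr gi]; rewrite /clim.
have -> : lim (Re (c * f x + g x) @[x --> F]) =
    Re c * lim (Re (f x) @[x --> F]) - Im c * lim (Im (f x) @[x --> F])
    + lim (Re (g x) @[x --> F]).
  under eq_fun do rewrite Re_lin.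
  by apply/cvg_lim => //; apply: cvgD => //; apply: cvgB; apply: cvgMl_tmp.
have -> : lim (Im (c * f x + g x) @[x --> F]) =
    Re c * lim (Im (f x) @[x --> F]) + Im c * lim (Re (f x) @[x --> F])
    + lim (Im (g x) @[x --> F]).
  under eq_fun do rewrite Im_lin.
  by apply/cvg_lim => //; apply: cvgD => //; apply: cvgD; apply: cvgMl_tmp.
by case: c.
Qed.

Lemma clim_eq (F : set_system R) f (c : R[i]) (h : R -> R) (l : R) : ProperFilter F ->
  (\forall x \near F, f x = c * (h x)%:C) -> h x @[x --> F] --> l ->
  clim F f = c * l%:C.
Proof.
move=> FF fh hl.
have -> : c * l%:C = Re c * l +i* (Im c * l).
  by case: c {fh} => a b; rewrite /GRing.mul /= !mulr0 subr0 add0r.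
rewrite /clim; congr (_ +i* _); apply/cvg_lim => //.
  have : Re c * h x @[x --> F] --> Re c * l by exact: cvgMl_tmp.
  apply: cvg_trans; apply: near_eq_cvg; apply: filterS fh => x ->.
  by rewrite /= Re_mul_real.
have : Im c * h x @[x --> F] --> Im c * l by exact: cvgMl_tmp.
apply: cvg_trans; apply: near_eq_cvg; apply: filterS fh => x ->.
by rewrite /= Im_mul_real.
Qed.
End limits.

(** * The maximal domain, boundary values and integrals over [Omega] *)

Section interval_union.
Context {R : realType} {n : nat}.
Variables alpha beta : 'I_n -> R.
Hypothesis alpha_lt_beta : forall i, alpha i < beta i.
Hypothesis beta_lt_alpha : forall i j : 'I_n,
  nat_of_ord j = (nat_of_ord i).+1 -> beta i < alpha j.
Implicit Types (f g : R -> R[i]).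
Local Notation Re := complex.Re.
Local Notation Im := complex.Im.
Local Notation J := (J alpha beta).
Local Notation Omega := (Omega alpha beta).
Local Notation Dmax := (Dmax alpha beta).

(** Induction on [j], since the hypothesis only compares consecutive intervals. *)
Lemma beta_lt_alpha_lt (i j : 'I_n) : (i < j)%N -> beta i < alpha j.
Proof.
move: j => [j jn] /=; elim: j jn => // j IH jn.
have jn' : (j < n)%N by exact: ltn_trans jn.
rewrite ltnS leq_eqVlt => /predU1P[ij|ij].
  by apply: beta_lt_alpha; rewrite /= ij.
apply: lt_trans (IH jn' ij) _; apply: lt_trans (alpha_lt_beta _) _.
exact: beta_lt_alpha.
Qed.

Lemma J_inj (i j : 'I_n) t : J i t -> J j t -> i = j.
Proof.
rewrite /J /= !in_itv /= => /andP[it ti] /andP[jt tj].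
apply/val_inj; case: (ltngtP i j) => // /beta_lt_alpha_lt H.
- by have := lt_trans (lt_trans ti H) jt; rewrite ltxx.
- by have := lt_trans (lt_trans tj H) it; rewrite ltxx.
Qed.

Lemma J_sub_Omega i : J i `<=` Omega.
Proof. by move=> t Jt; exists i. Qed.

Lemma measurable_Omega : measurable Omega.
Proof.
apply: fin_bigcup_measurable => [|i _]; first exact: finite_finset.
exact: measurable_itv.
Qed.

Lemma Dmax_lin c f g : Dmax f -> Dmax g -> Dmax (fun x => c * f x + g x).
Proof.
move=> [f0 f2 fac fd fd2] [g0 g2 gac gd gd2]; split.
- by move=> x nx; rewrite f0 ?g0 // mulr0 addr0.
- by apply: square_integrable_lin => //; exact: measurable_Omega.
- by move=> i; exact: abs_continuous_on_lin.
- move: (ae_and fd gd); apply: ae_imply => x [fx gx] Ox.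
  by have [] := cderivable_lin c (fx Ox) (gx Ox).
- have [h [hr hi hoo dh]] := square_integrable_lin c measurable_Omega fd2 gd2.
  exists h; split => //.
  move: (ae_and dh (ae_and fd gd)); apply: ae_imply => x [hx [fx gx]] Ox.
  by have [_ ->] := cderivable_lin c (fx Ox) (gx Ox); exact: hx.
Qed.

Lemma Dmax_ccvg f i : Dmax f -> ccvg (alpha i)^'+ f /\ ccvg (beta i)^'- f.
Proof.
move=> [_ _ /(_ i)/abs_continuous_onP[fr fi] _ _]; split; split.
- exact: ac_cvg_right (alpha_lt_beta i) fr.
- exact: ac_cvg_right (alpha_lt_beta i) fi.
- exact: ac_cvg_left (alpha_lt_beta i) fr.
- exact: ac_cvg_left (alpha_lt_beta i) fi.
Qed.

Lemma trace_alpha_lin c f g : Dmax f -> Dmax g ->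
  trace_alpha alpha (fun x => c * f x + g x) =
  c *: trace_alpha alpha f + trace_alpha alpha g.
Proof.
move=> Df Dg; apply/colP => i; rewrite !mxE.
exact: clim_lin (Dmax_ccvg i Df).1 (Dmax_ccvg i Dg).1.
Qed.

Lemma trace_beta_lin c f g : Dmax f -> Dmax g ->
  trace_beta beta (fun x => c * f x + g x) =
  c *: trace_beta beta f + trace_beta beta g.
Proof.
move=> Df Dg; apply/colP => i; rewrite !mxE.
exact: clim_lin (Dmax_ccvg i Df).2 (Dmax_ccvg i Dg).2.
Qed.

Lemma integral_expR_J (K : R) i : K != 0 ->
  (\int[mu]_(t in J i) (expR (K * t))%:E =
   ((expR (K * beta i) - expR (K * alpha i)) / K)%:E)%E.
Proof.
move=> K0.
have dE (t : R) : is_derive t 1 (fun t => expR (K * t) / K) (expR (K * t)).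
  have -> : (fun t => expR (K * t) / K) = K^-1 \*: (fun t => expR (K * t)).
    by apply/funext => s; rewrite mulrC.
  apply: is_derive_eq (is_deriveZ _ (is_derive_expRM K t)) _.
  by rewrite /GRing.scale /= mulrA mulVf // mul1r.
have cF : continuous (fun t : R => expR (K * t) / K).
  by move=> t; apply: cvgM; [exact: continuous_expRM | exact: cvg_cst].
(* The endpoints are added, as the fundamental theorem is applied on the closed interval. *)
rewrite -(@integral_itv_bndoo _ _ _ _ true false); last first.
  apply/measurable_EFinP; apply: measurable_funS measurableT _ _ => //.
  by apply: continuous_measurable_fun; exact: continuous_expRM.
rewrite (continuous_FTC2 (alpha_lt_beta i) _ (F := fun t => expR (K * t) / K)).
- by rewrite -EFinB mulrBl.
- by apply: continuous_in_subspaceT => t _; exact: continuous_expRM.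
- split=> [t _||].
  + by case: (dE t).
  + by apply: cvg_at_right_filter; exact: cF.
  + by apply: cvg_at_left_filter; exact: cF.
- by move=> t _; rewrite derive1E; case: (dE t).
Qed.

Lemma integrable_expR_J (K : R) i :
  mu.-integrable Omega (fun t => (expR (K * t) * \1_(J i) t)%:E).
Proof.
apply: (@integrableS _ _ _ _ setT) => //; first exact: measurable_Omega.
have -> : (fun t => (expR (K * t) * \1_(J i) t)%:E) =
    (EFin \o (fun t => expR (K * t))) \_ (J i).
  by rewrite epatch_indic.
have mJ : measurable (J i) by exact: measurable_itv.
refine (proj1 (@integrable_mkcond _ _ R (@lebesgue_measure R) _ _ mJ) _).
apply: (@integrableS _ _ R (@lebesgue_measure R) `[alpha i, beta i]) => //.
- by move=> t; rewrite /J /= !in_itv /= => /andP[/ltW -> /ltW ->].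
- apply: continuous_compact_integrable; first exact: segment_compact.
  apply: continuous_in_subspaceT => t _; exact: continuous_expRM.
Qed.

(** Norms and inner products of combinations of exponentials of rate [k] reduce to this integral
    with [K = 2 * k]. *)
Lemma integral_sum_expR_J (K : R) (w : 'I_n -> R) : K != 0 ->
  (\int[mu]_(t in Omega) (\sum_i w i * (expR (K * t) * \1_(J i) t))%:E =
   (\sum_i w i * ((expR (K * beta i) - expR (K * alpha i)) / K))%:E)%E.
Proof.
move=> K0; under eq_integral do rewrite -sumEFin.
have mO := measurable_Omega.
rewrite integral_sum //; last first.
  move=> i; under eq_fun do rewrite EFinM.
  by apply: integrableZl => //; exact: integrable_expR_J.
rewrite -sumEFin; apply: eq_bigr => i _.
under eq_integral do rewrite EFinM.
rewrite integralZl //; last exact: integrable_expR_J.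
rewrite EFinM -integral_expR_J //; congr (_ * _)%E.
have -> : (fun t => (expR (K * t) * \1_(J i) t)%:E) =
    (EFin \o (fun t => expR (K * t))) \_ (J i).
  by rewrite epatch_indic.
by rewrite -integral_mkcondr setIC setIidl //; exact: J_sub_Omega.
Qed.


(** * Combinations of exponentials supported on the intervals *)

Section exponentials.
Variables (g : 'I_n -> R) (k : R).
Implicit Types (c d : 'cV[R[i]]_n).

(** The choices ([gamma_plus], -2 pi) and ([gamma_minus], 2 pi) of ([g], [k]) give the two bases, so
    both deficiency spaces are treated at once. *)
Definition expJ (i : 'I_n) (t : R) : R[i] := (g i * expR (k * t) * \1_(J i) t)%:C.

Definition comb c (t : R) : R[i] := \sum_i c i 0 * expJ i t.

Lemma comb_J c i t : J i t -> comb c t = c i 0 * (g i * expR (k * t))%:C.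
Proof.
move=> Jt; rewrite /comb (bigD1 i) //= big1 ?addr0 => [|j ji].
  by rewrite /expJ indicE mem_set // mulr1.
rewrite /expJ indicE memNset ?mulr0 // => Jj.
by move: ji; rewrite (J_inj Jj Jt) eqxx.
Qed.

Lemma comb_notin c t : ~ Omega t -> comb c t = 0.
Proof.
move=> nO; apply: big1 => i _; rewrite /expJ indicE memNset ?mulr0 //.
by move=> Jt; apply: nO; exists i.
Qed.

Lemma comb_lin (a : R[i]) c d : comb (a *: c + d) = (fun t => a * comb c t + comb d t).
Proof.
apply/funext => t; rewrite /comb mulr_sumr -big_split; apply: eq_bigr => i _.
by rewrite !mxE /= mulrDl mulrA.
Qed.

Lemma comb_delta j : comb (delta_mx j 0) = expJ j.
Proof.
apply/funext => t; rewrite /comb (bigD1 j) //= big1 ?addr0 => [|i ij].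
  by rewrite mxE !eqxx mul1r.
by rewrite mxE (negPf ij) mul0r.
Qed.

Lemma J_near i t : J i t -> \forall s \near t, J i s.
Proof. by move=> Jt; apply: near_in_itvoo; rewrite inE. Qed.

(** [J i] is open and the intervals are disjoint, so near [t] the sum is a single exponential. *)
Lemma comb_derive c t : Omega t ->
  cderivable (comb c) t /\ cderive (comb c) t = k%:C * comb c t.
Proof.
move=> [i _ Jt].
have dE (x : R) : is_derive t 1 (fun s => x * (g i * expR (k * s)))
    (k * (x * (g i * expR (k * t)))).
  have -> : (fun s => x * (g i * expR (k * s))) = (x * g i) \*: (fun s => expR (k * s)).
    by apply/funext => s; rewrite mulrA.
  apply: is_derive_eq (is_deriveZ _ (is_derive_expRM k t)) _.
  by rewrite /GRing.scale /=; ring.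
have dr : is_derive t 1 (fun s => Re (comb c s)) (k * Re (comb c t)).
  have -> : Re (comb c t) = Re (c i 0) * (g i * expR (k * t)).
    by rewrite (comb_J c Jt) Re_mul_real.
  apply: near_eq_is_derive (dE _); near=> s.
  rewrite (@comb_J c i); last by near: s; exact: J_near.
  by rewrite Re_mul_real.
have di : is_derive t 1 (fun s => Im (comb c s)) (k * Im (comb c t)).
  have -> : Im (comb c t) = Im (c i 0) * (g i * expR (k * t)).
    by rewrite (comb_J c Jt) Im_mul_real.
  apply: near_eq_is_derive (dE _); near=> s.
  rewrite (@comb_J c i); last by near: s; exact: J_near.
  by rewrite Im_mul_real.
case: dr => dr er; case: di => di ei; split=> //.
rewrite /cderive !derive1E er ei.
by case: (comb c t) => a b; rewrite /GRing.mul /= !mul0r subr0 addr0.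
Unshelve. all: by end_near. Qed.

Lemma ac0 A : ac A (fun=> 0 : R).
Proof.
move=> e e0; exists 1 => // l _ _ _.
by rewrite big1 // => p _; rewrite subrr normr0.
Qed.

Lemma comb_ac c i : abs_continuous_on (J i) (comb c).
Proof.
suff H (p : R[i] -> R) (a : R) :
    (forall t, J i t -> p (comb c t) = a * (g i * expR (k * t))) ->
    ac (J i) (fun t => p (comb c t)).
  apply/abs_continuous_onP; split.
    apply: (H (@complex.Re R) (Re (c i 0))) => t Jt; rewrite (comb_J _ Jt).
    by rewrite Re_mul_real.
  apply: (H (@complex.Im R) (Im (c i 0))) => t Jt; rewrite (comb_J _ Jt).
  by rewrite Im_mul_real.
move=> pE; pose B := `|k| * (`|alpha i| + `|beta i|).
have kB t : J i t -> k * t <= B.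
  rewrite /J /= in_itv /= => /andP[at_ tb].
  by apply: itv_mulr_le; rewrite !ltW.
(* The exponential is Lipschitz on the bounded interval: domination with [u = 0]. *)
apply: (ac_dominated (C := `|a| * `|g i| * (expR B * `|k|)) (ac0 (J i))).
move=> s t Js Jt st; rewrite /= !pE // subrr normr0 add0r -!mulrBr !normrM -!mulrA.
rewrite !ler_wpM2l // (le_trans (expR_lipschitz (kB _ Jt) (kB _ Js))) //.
have ts : `|t - s| = t - s by rewrite ger0_norm ?subr_ge0.
by rewrite -mulrBr normrM ts.
Qed.

Lemma sum_indic_J (w : 'I_n -> R) (K : R) i t : J i t ->
  \sum_j w j * (expR (K * t) * \1_(J j) t) = w i * expR (K * t).
Proof.
move=> Jt; rewrite (bigD1 i) //= big1 ?addr0 => [|j ji].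
  by rewrite indicE mem_set // mulr1.
rewrite indicE memNset ?mulr0 // => Jj.
by move: ji; rewrite (J_inj Jj Jt) eqxx.
Qed.

Lemma measurable_comb c : measurable_fun Omega (fun t => Re (comb c t)) /\
  measurable_fun Omega (fun t => Im (comb c t)).
Proof.
have H (p : R[i] -> R) :
    (forall t, p (comb c t) =
       \sum_i p (c i 0) * (g i * expR (k * t) * \1_(J i) t)) ->
    measurable_fun Omega (fun t => p (comb c t)).
  move=> pE; under eq_fun do rewrite pE.
  apply: measurable_sum => i; apply: measurable_funM => //.
  apply: measurable_funM; last by apply: measurable_indic; exact: measurable_itv.
  apply: measurable_funM => //; apply: measurable_funS measurableT _ _ => //.
  by apply: continuous_measurable_fun; exact: continuous_expRM.
split; apply: H => t; rewrite /comb.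
  rewrite (big_morph (@complex.Re R) (id1 := 0) (op1 := +%R)) //; last by case=> ? ? [].
  by apply: eq_bigr => i _; rewrite Re_mul_real.
rewrite (big_morph (@complex.Im R) (id1 := 0) (op1 := +%R)) //; last by case=> ? ? [].
by apply: eq_bigr => i _; rewrite Im_mul_real.
Qed.

Hypothesis k_neq0 : k != 0.

Lemma comb_square_integrable c : square_integrable Omega (comb c).
Proof.
have [mr mi] := measurable_comb c.
exists (comb c); split => //; last exact: aeW.
have k2 : 2 * k != 0 by rewrite mulf_neq0.
(* On [J i] one term survives, and its squared modulus is an exponential of rate [2 * k]. *)
rewrite (_ : (\int[mu]_(x in Omega) _)%E = (\int[mu]_(t in Omega)
  (\sum_i ((Re (c i 0) ^+ 2 + Im (c i 0) ^+ 2) * g i ^+ 2) *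
          (expR (2 * k * t) * \1_(J i) t))%:E)%E).
  by rewrite integral_sum_expR_J // ltry.
apply: eq_integral => t; rewrite inE => -[i _ Jt]; congr (_%:E).
rewrite (@sum_indic_J (fun i => (Re (c i 0) ^+ 2 + Im (c i 0) ^+ 2) * g i ^+ 2) _ i) //.
by rewrite (comb_J _ Jt) Re_mul_real Im_mul_real -(mulrA 2) mulr_natl mulr2n expRD; ring.
Qed.

Lemma comb_Dmax c : Dmax (comb c).
Proof.
split.
- exact: comb_notin.
- exact: comb_square_integrable.
- exact: comb_ac.
- by apply: aeW => t /(comb_derive c)[].
(* The derivative is again a combination, with coefficients multiplied by [k]. *)
- have [mr mi] := measurable_comb (k%:C *: c).
  have [h [hr hi hoo hE]] := comb_square_integrable (k%:C *: c).
  exists h; split => //; move: hE; apply: ae_imply => t hE Ot.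
  rewrite -hE //; have [_ ->] := comb_derive c Ot.
  by rewrite /comb mulr_sumr; apply: eq_bigr => i _; rewrite mxE mulrA.
Qed.

Lemma trace_alpha_comb c :
  trace_alpha alpha (comb c) = \col_i (c i 0 * (g i * expR (k * alpha i))%:C).
Proof.
apply/colP => i; rewrite !mxE.
apply: (@clim_eq R _ _ _ (fun t => g i * expR (k * t))).
  near=> t; apply: comb_J; rewrite /J /= in_itv /=; apply/andP; split.
    by near: t; exact: nbhs_right_gt.
  by near: t; apply: nbhs_right_lt.
apply: cvgMl_tmp; apply: cvg_at_right_filter; exact: continuous_expRM.
Unshelve. all: by end_near. Qed.

Lemma trace_beta_comb c :
  trace_beta beta (comb c) = \col_i (c i 0 * (g i * expR (k * beta i))%:C).
Proof.
apply/colP => i; rewrite !mxE.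
apply: (@clim_eq R _ _ _ (fun t => g i * expR (k * t))).
  near=> t; apply: comb_J; rewrite /J /= in_itv /=; apply/andP; split.
    by near: t; apply: nbhs_left_gt.
  by near: t; exact: nbhs_left_lt.
apply: cvgMl_tmp; apply: cvg_at_left_filter; exact: continuous_expRM.
Unshelve. all: by end_near. Qed.

Hypothesis g_neq0 : forall i, g i != 0.

(** By [ac_ode] on real and imaginary parts, [f] is a multiple of e^(k t) on each [J i]; off [Omega]
    both sides vanish by the choice of representative in [Dmax]. *)
Lemma comb_spanning f : Dmax f ->
  {ae mu, forall t, Omega t -> cderive f t = k%:C * f t} -> exists c, f = comb c.
Proof.
move=> [f0 _ fac fd _] fk.
have fJ i : exists a : R[i], forall t, J i t -> f t = a * (expR (k * t))%:C.
  have /abs_continuous_onP[fr fi] := fac i.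
  have dr : {ae mu, forall t, t \in `]alpha i, beta i[ ->
      is_derive t 1 (fun t => Re (f t)) (k * Re (f t))}.
    move: (ae_and fd fk); apply: ae_imply => t [dt et] Jt.
    have Ot : Omega t by exists i.
    have [dr _] := dt Ot; apply: (DeriveDef dr).
    rewrite -derive1E; have := congr1 (@complex.Re R) (et Ot); rewrite /= => ->.
    by rewrite mulrC Re_mul_real mulrC.
  have di : {ae mu, forall t, t \in `]alpha i, beta i[ ->
      is_derive t 1 (fun t => Im (f t)) (k * Im (f t))}.
    move: (ae_and fd fk); apply: ae_imply => t [dt et] Jt.
    have Ot : Omega t by exists i.
    have [_ di] := dt Ot; apply: (DeriveDef di).
    rewrite -derive1E; have := congr1 (@complex.Im R) (et Ot); rewrite /= => ->.
    by rewrite mulrC Im_mul_real mulrC.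
  have [a ar] := ac_ode fr dr; have [b bi] := ac_ode fi di.
  exists (a +i* b) => t Jt; have := ar t Jt; have := bi t Jt.
  case: (f t) => x y /= -> ->.
  by rewrite /GRing.mul /= !mulr0 subr0 add0r.
have [a aE] := choice fJ.
exists (\col_i (a i / (g i)%:C)); apply/funext => t.
have [Ot|nO] := pselect (Omega t); last by rewrite f0 ?comb_notin.
have [i _ Jt] := Ot.
rewrite (comb_J _ Jt) mxE (aE _ _ Jt) rmorphM mulrA divfK //.
by rewrite fmorph_eq0.
Qed.

(** That is, each [expJ i] has norm 1. *)
Hypothesis norm_g : forall i,
  g i ^+ 2 * ((expR (2 * k * beta i) - expR (2 * k * alpha i)) / (2 * k)) = 1.

Lemma inner_product_comb c d :
  inner_product Omega (comb c) (comb d) = \sum_i c i 0 * (d i 0)^*%C.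
Proof.
have k2 : 2 * k != 0 by rewrite mulf_neq0.
(* Here [p] stands for [Re] or [Im]: only real linearity matters, since the exponential factors are
   real. *)
have H (p : R[i] -> R) : {morph p : x y / x + y} -> p 0 = 0 ->
    (forall z (r : R), p (z * r%:C) = p z * r) ->
    Rintegral mu Omega (fun t => p (comb c t * (comb d t)^*%C)) =
    p (\sum_i c i 0 * (d i 0)^*%C).
  move=> pD p0 pZ; rewrite (big_morph p pD p0) /Rintegral.
  rewrite (_ : (\int[mu]_(x in Omega) _)%E = (\int[mu]_(t in Omega)
    (\sum_i (p (c i 0 * (d i 0)^*%C) * g i ^+ 2) *
            (expR (2 * k * t) * \1_(J i) t))%:E)%E).
    rewrite integral_sum_expR_J //=; apply: eq_bigr => i _.
    by rewrite -mulrA norm_g mulr1.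
  apply: eq_integral => t; rewrite inE => -[i _ Jt]; congr (_%:E).
  rewrite (@sum_indic_J (fun i => p (c i 0 * (d i 0)^*%C) * g i ^+ 2) _ i) //.
  rewrite !(comb_J _ Jt) -(mulrA 2) -(mulrA (p _)) mulr_natl mulr2n expRD -pZ; congr p.
  rewrite conjc_mul_real mulrACA -rmorphM mulrA; congr (_ * _%:C); ring.
rewrite /inner_product (H (@complex.Re R)) ?(H (@complex.Im R)) //; try by case=> ? ? [].
- by case: (\sum_i _).
- exact: Im_mul_real.
- exact: Re_mul_real.
Qed.

End exponentials.

End interval_union.

(** * Unitary Moebius transformations *)

Section adjoint.
Context {C : numClosedFieldType}.
Implicit Types (m n p : nat).

Lemma trmxC_mul m n p (A : 'M[C]_(m, n)) (B : 'M[C]_(n, p)) :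
  (A *m B)^t* = B^t* *m A^t*.
Proof. by rewrite trmx_mul map_mxM. Qed.

Lemma trmxCD m n (A B : 'M[C]_(m, n)) : (A + B)^t* = A^t* + B^t*.
Proof. by rewrite linearD map_mxD. Qed.

Lemma trmxC_unit n (A : 'M[C]_n) : (A^t* \in unitmx) = (A \in unitmx).
Proof. by rewrite map_unitmx unitmx_tr. Qed.

Lemma mulmx_trmxC_eq0 n (u : 'rV[C]_n) : u *m u^t* = 0 -> u = 0.
Proof.
move=> /matrixP /(_ ord0 ord0); rewrite !mxE => /eqP.
rewrite psumr_eq0 => [/allP u0|i _]; last by rewrite !mxE mul_conjC_ge0.
apply/rowP => i; have := u0 i (mem_index_enum _).
by rewrite !mxE mul_conjC_eq0 => /eqP.
Qed.

(* If [v X = 0] then [|v Y|^2 = |v X|^2 = 0], hence [k v = v X S + v Y T = 0]. *)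
Lemma eq_gram_unitmx n (X Y S T : 'M[C]_n) (k : C) :
  X *m X^t* = Y *m Y^t* -> X *m S + Y *m T = k%:M -> k != 0 -> X \in unitmx.
Proof.
move=> XY XSYT k0; rewrite -row_free_unit -kermx_eq0; apply/eqP/row_matrixP => i.
set v := row i _; have vX : v *m X = 0 by apply/sub_kermxP; exact: row_sub.
have vY : v *m Y = 0.
  apply: mulmx_trmxC_eq0.
  by rewrite trmxC_mul mulmxA -(mulmxA v) -XY mulmxA vX !mul0mx.
have : v *m k%:M = 0 by rewrite -XSYT mulmxDr !mulmxA vX vY !mul0mx addr0.
by rewrite mul_mx_scalar row0 => /eqP; rewrite scaler_eq0 (negPf k0) => /eqP.
Qed.

(** X^-1 Y Y^* X^-* = X^-1 X X^* X^-* = 1. *)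
Lemma eq_gram_unitary n (X Y : 'M[C]_n) :
  X *m X^t* = Y *m Y^t* -> X \in unitmx -> invmx X *m Y \is unitarymx.
Proof.
move=> XY Xu; apply/unitarymxP.
rewrite trmxC_mul mulmxA -(mulmxA (invmx X)) -XY mulKmx //.
by rewrite -trmxC_mul mulVmx // trmx1 map_mx1.
Qed.
End adjoint.

(** * The map M -> (P M + Q) (Q M + P)^-1 for commuting Hermitian P, Q with P^2 - Q^2 scalar *)

Section moebius.
Context {C : numClosedFieldType} {n : nat}.
Variables (P Q : 'M[C]_n) (k : C).
Hypotheses (k_neq0 : k != 0) (PH : P^t* = P) (QH : Q^t* = Q).
Hypotheses (PQC : P *m Q = Q *m P) (PQk : P *m P - Q *m Q = k%:M).
Implicit Types M B : 'M[C]_n.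

Lemma mulmxPP : P *m P = Q *m Q + k%:M.
Proof. by rewrite -PQk addrC subrK. Qed.

(** After expansion the cross terms agree because [P] and [Q] commute; replacing P^2 by Q^2 + k on
    both sides and using M^* M = 1 matches the rest. *)
Lemma moebius_gram M : M \is unitarymx ->
  (Q *m M + P)^t* *m (Q *m M + P) = (P *m M + Q)^t* *m (P *m M + Q).
Proof.
move=> Mu; have MM : M^t* *m M = 1%:M by apply/mulmx1C/unitarymxP.
rewrite !trmxCD !trmxC_mul PH QH !mulmxDl !mulmxDr !mulmxA.
rewrite -(mulmxA _ P P) -(mulmxA (M^t*) P Q) PQC !mulmxA -(mulmxA _ P P) mulmxPP.
rewrite mulmxDr mulmxDl !mulmxA mul_mx_scalar -scalemxAl MM scalemx1.
by rewrite (addrAC _ k%:M) -[RHS]addrA [k%:M + _]addrC !addrA.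
Qed.

Lemma moebius_comb M : P *m (Q *m M + P) - Q *m (P *m M + Q) = k%:M.
Proof.
by rewrite !mulmxDr !mulmxA PQC opprD addrACA subrr add0r.
Qed.

Lemma moebius_unit M : M \is unitarymx -> Q *m M + P \in unitmx.
Proof.
move=> Mu; rewrite -trmxC_unit.
have k0 : k^* != 0 by rewrite conjC_eq0.
(* The criterion concerns row kernels, so it is applied to the adjoints; the linear relation is the
   adjoint of [moebius_comb], which conjugates [k]. *)
apply: (@eq_gram_unitmx _ _ _ ((P *m M + Q)^t*) P (- Q) k^*) k0.
  by rewrite !trmxCK moebius_gram.
have /(congr1 (fun X => X^t*)) := moebius_comb M.
by rewrite trmxCD linearN map_mxN !trmxC_mul PH QH tr_scalar_mx map_scalar_mx mulmxN.
Qed.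

Lemma moebius_unitary M : M \is unitarymx ->
  (P *m M + Q) *m invmx (Q *m M + P) \is unitarymx.
Proof.
move=> Mu; rewrite -trmxC_unitary trmxC_mul.
have -> : (invmx (Q *m M + P))^t* = invmx ((Q *m M + P)^t*).
  by rewrite -map_invmx trmx_inv.
apply: eq_gram_unitary; first by rewrite !trmxCK moebius_gram.
by rewrite trmxC_unit moebius_unit.
Qed.

(** Clearing the denominator turns the relation into a linear equation for [M] when [B] is given;
    this serves both existence and uniqueness of [M]. *)
Lemma moebius_solve M B : M \is unitarymx -> B \is unitarymx ->
  (B = (P *m M + Q) *m invmx (Q *m M + P)) <->
  ((P - B *m Q) *m M = B *m P - Q).
Proof.
move=> Mu Bu; have Du := moebius_unit Mu.
have -> : (B = (P *m M + Q) *m invmx (Q *m M + P)) <->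
   (B *m (Q *m M + P) = P *m M + Q).
  by split=> [->|<-]; rewrite ?mulmxKV ?mulmxK.
rewrite mulmxDr mulmxBl mulmxA; split=> /eqP H; apply/eqP.
  by rewrite subr_eq addrAC eq_sym subr_eq addrC.
by move: H; rewrite subr_eq addrAC eq_sym subr_eq addrC.
Qed.

(** The computation of [moebius_gram], now with B B^* = 1. *)
Lemma moebius_inv_gram B : B \is unitarymx ->
  (P - B *m Q) *m (P - B *m Q)^t* = (B *m P - Q) *m (B *m P - Q)^t*.
Proof.
move=> /unitarymxP BB; rewrite !trmxCD !linearN !map_mxN !trmxC_mul PH QH.
rewrite !mulmxBl !mulmxBr !mulmxA -(mulmxA B P P) mulmxPP mulmxDr mulmxDl.
rewrite mul_mx_scalar -scalemxAl BB scalemx1 !mulmxA -!(mulmxA B) PQC.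
rewrite !opprB -!addrA (addrCA _ k%:M) [in RHS](addrCA _ k%:M); congr (_ + _).
by rewrite addrA addrC -addrA.
Qed.

Lemma moebius_inv_comb B : (P - B *m Q) *m P + (B *m P - Q) *m Q = k%:M.
Proof. by rewrite !mulmxBl -!mulmxA PQC addrA subrK PQk. Qed.

Lemma moebius_inv_unit B : B \is unitarymx -> P - B *m Q \in unitmx.
Proof.
by move=> /moebius_inv_gram Bg; exact: eq_gram_unitmx Bg (moebius_inv_comb B) k_neq0.
Qed.

Lemma moebius_inv_unitary B : B \is unitarymx ->
  invmx (P - B *m Q) *m (B *m P - Q) \is unitarymx.
Proof.
by move=> Bu; exact: eq_gram_unitary (moebius_inv_gram Bu) (moebius_inv_unit Bu).
Qed.

End moebius.

(** * Deficiency spaces *)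

Section deficiency_spaces.
Context {R : realType} {n : nat}.
Variables alpha beta : 'I_n -> R.
Hypothesis alpha_lt_beta : forall i, alpha i < beta i.
Hypothesis beta_lt_alpha : forall i j : 'I_n,
  nat_of_ord j = (nat_of_ord i).+1 -> beta i < alpha j.
Implicit Types (f g : R -> R[i]) (W : (R -> R[i]) -> R -> R[i]) (c d : 'cV[R[i]]_n).
Local Notation Omega := (Omega alpha beta).
Local Notation Dmax := (Dmax alpha beta).
Local Notation gm := (gamma_minus alpha beta).
Local Notation gp := (gamma_plus alpha beta).
Local Notation combp := (comb alpha beta gp (- (2 * pi))).
Local Notation combm := (comb alpha beta gm (2 * pi)).
Local Notation P := (Gamma_minus alpha beta *m E (fun i => 2 * pi * beta i)).
Local Notation Q := (Gamma_minus alpha beta *m E (fun i => 2 * pi * alpha i)).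
Local Notation unitary := (unitary_Lplus_Lminus alpha beta).
Local Notation matrix_of := (matrix_of alpha beta).

Let pi2_gt0 : 0 < 2 * pi :> R. Proof. by rewrite mulr_gt0 ?pi_gt0. Qed.

(** * Identities between the normalizing constants *)

Lemma expR_4pi (x : R) : expR (4 * pi * x) = expR (2 * pi * x) ^+ 2.
Proof. by rewrite -expRM_natl -mulr_natr; congr expR; ring. Qed.

Lemma expR_lt_2pi i : expR (2 * pi * alpha i) ^+ 2 < expR (2 * pi * beta i) ^+ 2.
Proof. by rewrite -!expR_4pi ltr_expR ltr_pM2l // mulr_gt0 ?pi_gt0. Qed.

Lemma gamma_minus_sqr i :
  gm i ^+ 2 = 4 * pi / (expR (2 * pi * beta i) ^+ 2 - expR (2 * pi * alpha i) ^+ 2).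
Proof.
rewrite /gamma_minus -!expR_4pi sqr_sqrtr // divr_ge0 // ?mulr_ge0 ?pi_ge0 //.
by rewrite !expR_4pi subr_ge0 ltW ?expR_lt_2pi.
Qed.

Lemma gamma_minus_gt0 i : 0 < gm i.
Proof.
rewrite /gamma_minus !expR_4pi sqrtr_gt0 divr_gt0 ?mulr_gt0 ?pi_gt0 //.
by rewrite subr_gt0 expR_lt_2pi.
Qed.

(** With a = e^(2 pi alpha_i) and b = e^(2 pi beta_i), one has a^-2 - b^-2 = (b^2 - a^2) / (a
    b)^2. *)
Lemma gamma_plusE i : gp i = gm i * (expR (2 * pi * alpha i) * expR (2 * pi * beta i)).
Proof.
set a := expR (2 * pi * alpha i); set b := expR (2 * pi * beta i).
have ab : a ^+ 2 < b ^+ 2 by exact: expR_lt_2pi.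
have a0 : 0 < a by exact: expR_gt0.
have b0 : 0 < b by exact: expR_gt0.
rewrite -[RHS]ger0_norm; last by rewrite !mulr_ge0 // ltW ?gamma_minus_gt0.
rewrite -sqrtr_sqr /gamma_plus; congr Num.sqrt.
rewrite exprMn gamma_minus_sqr -/a -/b !expRN !expR_4pi -/a -/b.
by field; rewrite !gt_eqF //= ?subr_gt0 //; nra.
Qed.

Lemma gamma_plus_gt0 i : 0 < gp i.
Proof. by rewrite gamma_plusE !mulr_gt0 ?expR_gt0 ?gamma_minus_gt0. Qed.

Lemma gamma_plus_alpha :
  Gamma_plus alpha beta *m E (fun i => - (2 * pi * alpha i)) = P.
Proof.
rewrite /Gamma_plus /Gamma_minus /E !mulmx_diag; congr diag_mx; apply/rowP => i.
rewrite !mxE -!rmorphM gamma_plusE expRN; congr (_%:C).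
by field; rewrite gt_eqF ?expR_gt0.
Qed.

Lemma gamma_plus_beta :
  Gamma_plus alpha beta *m E (fun i => - (2 * pi * beta i)) = Q.
Proof.
rewrite /Gamma_plus /Gamma_minus /E !mulmx_diag; congr diag_mx; apply/rowP => i.
rewrite !mxE -!rmorphM gamma_plusE expRN; congr (_%:C).
by field; rewrite gt_eqF ?expR_gt0.
Qed.

Lemma Gamma_minus_E_conj (v : 'I_n -> R) :
  (Gamma_minus alpha beta *m E v)^t* = Gamma_minus alpha beta *m E v.
Proof.
rewrite /Gamma_minus /E !mulmx_diag tr_diag_mx map_diag_mx; congr diag_mx.
by apply/rowP => i; rewrite !mxE -rmorphM; exact: conjc_real.
Qed.

Lemma Gamma_minus_E_comm (v w : 'I_n -> R) :
  (Gamma_minus alpha beta *m E v) *m (Gamma_minus alpha beta *m E w) =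
  (Gamma_minus alpha beta *m E w) *m (Gamma_minus alpha beta *m E v).
Proof.
rewrite /Gamma_minus /E !mulmx_diag; congr diag_mx.
by apply/rowP => i; rewrite !mxE mulrC.
Qed.

Lemma Gamma_minus_sqrB : P *m P - Q *m Q = ((4 * pi)%:C : R[i])%:M.
Proof.
rewrite /Gamma_minus /E !mulmx_diag -linearB /= -diag_const_mx; congr diag_mx.
apply/rowP => i; rewrite !mxE -!rmorphM -rmorphB; congr (_%:C).
transitivity (gm i ^+ 2 * (expR (2 * pi * beta i) ^+ 2 - expR (2 * pi * alpha i) ^+ 2)).
  by ring.
by rewrite gamma_minus_sqr divfK // gt_eqF // subr_gt0 expR_lt_2pi.
Qed.

(** * Orthonormal coordinates on the deficiency spaces *)

Lemma basis_plusE i : basis_plus alpha beta i = combp (delta_mx i 0).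
Proof.
by rewrite comb_delta; apply/funext => t; rewrite /basis_plus /expJ mulNr.
Qed.

Lemma basis_minusE i : basis_minus alpha beta i = combm (delta_mx i 0).
Proof. by rewrite comb_delta. Qed.

Lemma combp_Dmax c : Dmax (combp c).
Proof. by apply: comb_Dmax => //; rewrite oppr_eq0 gt_eqF. Qed.

Lemma combm_Dmax c : Dmax (combm c).
Proof. by apply: comb_Dmax => //; rewrite gt_eqF. Qed.

Lemma sum_conj_delta c i : \sum_j c j 0 * ((delta_mx i 0 : 'cV[R[i]]_n) j 0)^*%C = c i 0.
Proof.
rewrite (bigD1 i) //= big1 ?addr0 => [|j ji]; first by rewrite mxE !eqxx conjc1 mulr1.
by rewrite mxE (negPf ji) conjc0 mulr0.
Qed.

Lemma inner_product_combp c d :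
  inner_product Omega (combp c) (combp d) = \sum_i c i 0 * (d i 0)^*%C.
Proof.
apply: inner_product_comb => //; first by rewrite oppr_eq0 gt_eqF.
move=> i; rewrite gamma_plusE !exprMn gamma_minus_sqr.
have H (x : R) : 2 * - (2 * pi) * x = - (4 * pi * x) by ring.
rewrite !H !expRN !expR_4pi.
move: (expR_lt_2pi i) (expR_gt0 (2 * pi * alpha i)).
move: (expR_gt0 (2 * pi * beta i)) (pi_gt0 R).
move: (expR (2 * pi * alpha i)) (expR (2 * pi * beta i)) pi.
move=> a b p b0 p0 ab a0.
by field; rewrite !gt_eqF ?subr_gt0.
Qed.

Lemma inner_product_combm c d :
  inner_product Omega (combm c) (combm d) = \sum_i c i 0 * (d i 0)^*%C.
Proof.
apply: inner_product_comb => //; first by rewrite gt_eqF.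
move=> i; rewrite gamma_minus_sqr.
have H (x : R) : 2 * (2 * pi) * x = 4 * pi * x by ring.
rewrite !H !expR_4pi.
move: (expR_lt_2pi i) (expR_gt0 (2 * pi * alpha i)).
move: (expR_gt0 (2 * pi * beta i)) (pi_gt0 R).
move: (expR (2 * pi * alpha i)) (expR (2 * pi * beta i)) pi.
move=> a b p b0 p0 ab a0.
by field; rewrite !gt_eqF ?subr_gt0.
Qed.

Lemma inner_product_combp_delta c i :
  inner_product Omega (combp c) (combp (delta_mx i 0)) = c i 0.
Proof. by rewrite inner_product_combp sum_conj_delta. Qed.

Lemma inner_product_combm_delta c i :
  inner_product Omega (combm c) (combm (delta_mx i 0)) = c i 0.
Proof. by rewrite inner_product_combm sum_conj_delta. Qed.

Let two_pi_i_neq0 : (2 * pi)%:C * 'i%C != 0 :> R[i].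
Proof.
apply: mulf_neq0; first by rewrite fmorph_eq0 gt_eqF.
by apply/eqP => -[] /eqP; rewrite oner_eq0.
Qed.

(** Multiplying by 2 pi i turns the eigenvalue equation into f' = -2 pi f, which [comb_spanning]
    solves. *)
Lemma LplusP f : Lplus alpha beta f <-> exists c, f = combp c.
Proof.
have uE (w z : R[i]) : ((2 * pi)%:C * 'i%C)^-1 * w - 'i%C * z = 0 <->
    w = (- (2 * pi))%:C * z.
  split=> [/eqP|->].
    rewrite subr_eq0 => /eqP H; rewrite -[w](mulKf two_pi_i_neq0) mulrCA H.
    by rewrite -mulrA (mulrA 'i%C) -expr2 sqr_i mulN1r mulrN rmorphN mulNr.
  apply: (mulfI two_pi_i_neq0); rewrite mulrBr mulr0 mulVKf //.
  by rewrite -[X in _ - X]mulrA (mulrA 'i%C) -expr2 sqr_i mulN1r mulrN rmorphN mulNr subrr.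
split=> [[Df fE]|[c ->]].
  apply: comb_spanning => //; first by move=> i; rewrite gt_eqF ?gamma_plus_gt0.
  by move: fE; apply: ae_imply => t fE Ot; apply/uE/fE.
split; first exact: combp_Dmax.
apply: aeW => t Ot; apply/uE.
by have [_ ->] := comb_derive alpha_lt_beta beta_lt_alpha gp (- (2 * pi)) c Ot.
Qed.

Lemma LminusP f : Lminus alpha beta f <-> exists c, f = combm c.
Proof.
have uE (w z : R[i]) : ((2 * pi)%:C * 'i%C)^-1 * w + 'i%C * z = 0 <->
    w = (2 * pi)%:C * z.
  split=> [/eqP|->].
    rewrite addr_eq0 => /eqP H; rewrite -[w](mulKf two_pi_i_neq0) mulrCA H.
    by rewrite mulrN -mulrA (mulrA 'i%C) -expr2 sqr_i mulN1r mulrN opprK.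
  apply: (mulfI two_pi_i_neq0); rewrite mulrDr mulr0 mulVKf //.
  by rewrite -[X in _ + X]mulrA (mulrA 'i%C) -expr2 sqr_i mulN1r mulrN subrr.
split=> [[Df fE]|[c ->]].
  apply: comb_spanning => //; first by move=> i; rewrite gt_eqF ?gamma_minus_gt0.
  by move: fE; apply: ae_imply => t fE Ot; apply/uE/fE.
split; first exact: combm_Dmax.
apply: aeW => t Ot; apply/uE.
by have [_ ->] := comb_derive alpha_lt_beta beta_lt_alpha gm (2 * pi) c Ot.
Qed.

Lemma trace_alpha_combp c : trace_alpha alpha (combp c) = P *m c.
Proof.
rewrite trace_alpha_comb // -gamma_plus_alpha /Gamma_plus /E mulmx_diag mul_diag_mx.
by apply/colP => i; rewrite !mxE mulrC mulNr rmorphM.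
Qed.

Lemma trace_beta_combp c : trace_beta beta (combp c) = Q *m c.
Proof.
rewrite trace_beta_comb // -gamma_plus_beta /Gamma_plus /E mulmx_diag mul_diag_mx.
by apply/colP => i; rewrite !mxE mulrC mulNr rmorphM.
Qed.

Lemma trace_alpha_combm c : trace_alpha alpha (combm c) = Q *m c.
Proof.
rewrite trace_alpha_comb // /Gamma_minus /E mulmx_diag mul_diag_mx.
by apply/colP => i; rewrite !mxE mulrC rmorphM.
Qed.

Lemma trace_beta_combm c : trace_beta beta (combm c) = P *m c.
Proof.
rewrite trace_beta_comb // /Gamma_minus /E mulmx_diag mul_diag_mx.
by apply/colP => i; rewrite !mxE mulrC rmorphM.
Qed.

(** * Unitaries, their matrices and boundary values *)

Lemma unitary_matrixP W : unitary W -> forall c, W (combp c) = combm (matrix_of W *m c).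
Proof.
move=> [WL Wlin _ _] c.
have LP d : Lplus alpha beta (combp d) by apply/LplusP; exists d.
have /choice[T TE] : forall d, exists e, W (combp d) = combm e.
  by move=> d; apply/LminusP/WL.
pose co d := \col_i inner_product Omega (W (combp d)) (combm (delta_mx i 0)).
have coE d : W (combp d) = combm (co d).
  rewrite TE; congr combm; apply/colP => i.
  by rewrite mxE TE inner_product_combm_delta.
have co_lin a d e : co (a *: d + e) = a *: co d + co e.
  apply/colP => i; rewrite !mxE comb_lin Wlin // !coE -comb_lin.
  by rewrite !inner_product_combm_delta !mxE.
(* Linearity is available only for a d + e, so 0 is written as -1 * 0 + 0. *)
have co0 : co 0 = 0.
  by rewrite -[X in co X](addNr 0) -scaleN1r co_lin scaleN1r addNr.
have coS (I : Type) (s : seq I) (a : I -> R[i]) (e : I -> 'cV_n) :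
    co (\sum_(j <- s) a j *: e j) = \sum_(j <- s) a j *: co (e j).
  by elim: s => [|j s IH]; rewrite ?big_nil // !big_cons co_lin IH.
rewrite coE; congr combm.
have -> : c = \sum_j c j 0 *: delta_mx j 0.
  by rewrite {1}[c]matrix_sum_delta; apply: eq_bigr => j _; rewrite big_ord1.
rewrite coS mulmx_sumr; apply: eq_bigr => j _; rewrite -scalemxAr; congr (_ *: _).
rewrite -colE; apply/colP => i; rewrite !mxE -basis_plusE -basis_minusE.
by [].
Qed.

Lemma matrix_of_unitary W : unitary W -> matrix_of W \is unitarymx.
Proof.
move=> uW; have WE := unitary_matrixP uW; have [_ _ Wip _] := uW.
apply/unitarymxP/mulmx1C/matrixP => i j.
have LP d : Lplus alpha beta (combp d) by apply/LplusP; exists d.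
(* The entry (i, j) of M^* M is the inner product of the images of the basis vectors [j] and [i], in
   this order. *)
have := Wip _ _ (LP (delta_mx j 0)) (LP (delta_mx i 0)).
rewrite !WE -!colE inner_product_combm inner_product_combp_delta !mxE eqxx andbT => <-.
by apply: eq_bigr => k _; rewrite !mxE mulrC.
Qed.

(** Traces are linear and vanish on [D0]. Conversely, subtracting the deficiency parts with
    coordinates [c] and M c leaves a function with zero traces, that is, an element of [D0]. *)
Lemma domWP W f : unitary W -> domW alpha beta W f <->
  Dmax f /\ exists c, trace_alpha alpha f = (Q *m matrix_of W + P) *m c /\
                      trace_beta beta f = (P *m matrix_of W + Q) *m c.
Proof.
move=> uW; have WE := unitary_matrixP uW.
split=> [[f0 [fp [[Df0 ta tb] /LplusP[c ->] ->]]]|[Df [c [ta tb]]]].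
  rewrite WE; set d := _ *m c.
  have -> : (fun x => f0 x + combp c x + combm d x) =
      (fun x => 1 * (1 * f0 x + combp c x) + combm d x).
    by apply/funext => x; rewrite !mul1r.
  have Dc := combp_Dmax c; have Dd := combm_Dmax d.
  have D1 := Dmax_lin 1 Df0 Dc.
  split; first exact: Dmax_lin.
  exists c; rewrite !(trace_alpha_lin alpha_lt_beta) // !(trace_beta_lin alpha_lt_beta) //.
  rewrite ta tb !scale1r !add0r trace_alpha_combp trace_alpha_combm.
  rewrite trace_beta_combp trace_beta_combm !mulmxDl /d !mulmxA.
  by rewrite [P *m c + _]addrC [Q *m c + _]addrC.
pose d := matrix_of W *m c.
have Dc := combp_Dmax c; have Dd := combm_Dmax d.
have D1 := Dmax_lin (-1) Dd Df.
exists (fun x => -1 * combp c x + (-1 * combm d x + f x)), (combp c).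
rewrite WE; split.
- split.
  + exact: Dmax_lin.
  + rewrite !(trace_alpha_lin alpha_lt_beta) // trace_alpha_combp trace_alpha_combm ta.
    by rewrite mulmxDl /d mulmxA !scaleN1r addKr addNr.
  + rewrite !(trace_beta_lin alpha_lt_beta) // trace_beta_combp trace_beta_combm tb.
    by rewrite mulmxDl /d mulmxA !scaleN1r addKr addNr.
- by apply/LplusP; exists c.
- by apply/funext => x; rewrite -/d; ring.
Qed.

Let four_pi_neq0 : (4 * pi)%:C != 0 :> R[i].
Proof. by rewrite fmorph_eq0 gt_eqF // mulr_gt0 ?pi_gt0. Qed.

Lemma Phi_solve M B : M \is unitarymx -> B \is unitarymx ->
  B = (P *m M + Q) *m invmx (Q *m M + P) <-> (P - B *m Q) *m M = B *m P - Q.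
Proof.
exact: (moebius_solve four_pi_neq0 (Gamma_minus_E_conj _) (Gamma_minus_E_conj _)
  (Gamma_minus_E_comm _ _) Gamma_minus_sqrB).
Qed.

Lemma Phi_den_unit M : M \is unitarymx -> Q *m M + P \in unitmx.
Proof.
exact: (moebius_unit four_pi_neq0 (Gamma_minus_E_conj _) (Gamma_minus_E_conj _)
  (Gamma_minus_E_comm _ _) Gamma_minus_sqrB).
Qed.

Lemma Phi_unitary M : M \is unitarymx ->
  (P *m M + Q) *m invmx (Q *m M + P) \is unitarymx.
Proof.
exact: (moebius_unitary four_pi_neq0 (Gamma_minus_E_conj _) (Gamma_minus_E_conj _)
  (Gamma_minus_E_comm _ _) Gamma_minus_sqrB).
Qed.

Lemma Phi_inv_den_unit B : B \is unitarymx -> P - B *m Q \in unitmx.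
Proof.
exact: (moebius_inv_unit four_pi_neq0 (Gamma_minus_E_conj _) (Gamma_minus_E_conj _)
  (Gamma_minus_E_comm _ _) Gamma_minus_sqrB).
Qed.

Lemma Phi_inv_unitary B : B \is unitarymx ->
  invmx (P - B *m Q) *m (B *m P - Q) \is unitarymx.
Proof.
exact: (moebius_inv_unitary four_pi_neq0 (Gamma_minus_E_conj _) (Gamma_minus_E_conj _)
  (Gamma_minus_E_comm _ _) Gamma_minus_sqrB).
Qed.

Lemma domW_eq_domB W B : unitary W ->
  domW alpha beta W = domB alpha beta B <->
  B = (P *m matrix_of W + Q) *m invmx (Q *m matrix_of W + P).
Proof.
move=> uW; have Du := Phi_den_unit (matrix_of_unitary uW).
set M := matrix_of W in Du *; split=> [WB|->].
  suff H : B *m (Q *m M + P) = P *m M + Q by rewrite -H mulmxK.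
  have HH c : B *m (Q *m M + P) *m c = (P *m M + Q) *m c.
    (* The elements of D_W with zero [D0] part realize every coordinate vector [c]; the factor 1
       gives the shape expected by the linearity lemmas. *)
    pose f x := 1 * combp c x + combm (M *m c) x.
    have Dc := combp_Dmax c; have Dd := combm_Dmax (M *m c).
    have ta : trace_alpha alpha f = (Q *m M + P) *m c.
      rewrite (trace_alpha_lin alpha_lt_beta) // scale1r.
      by rewrite trace_alpha_combp trace_alpha_combm mulmxDl addrC mulmxA.
    have tb : trace_beta beta f = (P *m M + Q) *m c.
      rewrite (trace_beta_lin alpha_lt_beta) // scale1r.
      by rewrite trace_beta_combp trace_beta_combm mulmxDl addrC mulmxA.
    have : domW alpha beta W f by apply/domWP => //; split; [exact: Dmax_lin | exists c].
    by rewrite WB => -[_]; rewrite ta tb mulmxA.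
  apply/matrixP => i j; have /colP/(_ i) := HH (delta_mx j 0).
  by rewrite -!colE !mxE.
apply/seteqP; split=> f.
  by move=> /domWP-/(_ uW)[Df [c [ta tb]]]; split=> //; rewrite ta tb mulmxA mulmxKV.
move=> [Df tt]; apply/domWP => //; split=> //.
(* The coordinates are forced by the values at [alpha]; those at [beta] then agree by the boundary
   condition. *)
exists (invmx (Q *m M + P) *m trace_alpha alpha f).
by rewrite mulmxA mulmxV // mul1mx -tt mulmxA.
Qed.

Lemma unitary_of_matrix M : M \is unitarymx ->
  exists2 W, unitary W & matrix_of W = M.
Proof.
move=> Mu; pose co f := \col_i inner_product Omega f (combp (delta_mx i 0)).
have coE c : co (combp c) = c.
  by apply/colP => i; rewrite mxE inner_product_combp_delta.
(* Defined on all functions through inner products with the basis; on [Lplus] these are the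
   coordinates. *)
pose W f := combm (M *m co f).
exists W; last first.
  apply/matrixP => i j; rewrite mxE basis_plusE basis_minusE /W coE.
  by rewrite inner_product_combm_delta -colE mxE.
split.
- by move=> f _; apply/LminusP; exists (M *m co f).
- move=> a f g /LplusP[c ->] /LplusP[d ->].
  by rewrite -comb_lin /W !coE -comb_lin mulmxDr -scalemxAr.
- move=> f g /LplusP[c ->] /LplusP[d ->]; rewrite /W !coE.
  rewrite inner_product_combm inner_product_combp.
  have ipE (u v : 'cV[R[i]]_n) : \sum_i u i 0 * (v i 0)^*%C = (v^t* *m u) 0 0.
    by rewrite mxE; apply: eq_bigr => i _; rewrite !mxE mulrC.
  rewrite !ipE trmxC_mul mulmxA -(mulmxA (d^t*)).
  by rewrite (mulmx1C (unitarymxP Mu)) mulmx1.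
- move=> g /LminusP[c ->]; exists (combp (M^t* *m c)).
    by apply/LplusP; exists (M^t* *m c).
  by rewrite /W coE mulmxA (unitarymxP Mu) mul1mx.
Qed.

End deficiency_spaces.

Theorem proposition3p14 (R : realType) (n : nat) (alpha beta : 'I_n -> R)
  (n_gt0 : (0 < n)%N)
  (alpha_lt_beta : forall i : 'I_n, alpha i < beta i)
  (beta_lt_alpha : forall i j : 'I_n, nat_of_ord j = (nat_of_ord i).+1 ->
     beta i < alpha j) :
  let unitary := unitary_Lplus_Lminus alpha beta in
  let num (M : 'M[R[i]]_n) :=
    Gamma_minus alpha beta *m E (fun i => 2 * pi * beta i) *m M
    + Gamma_plus alpha beta *m E (fun i => - (2 * pi * beta i)) in
  let den (M : 'M[R[i]]_n) :=
    Gamma_minus alpha beta *m E (fun i => 2 * pi * alpha i) *m M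
    + Gamma_plus alpha beta *m E (fun i => - (2 * pi * alpha i)) in
  let Phi (W : (R -> R[i]) -> (R -> R[i])) :=
    num (matrix_of alpha beta W) *m invmx (den (matrix_of alpha beta W)) in
  [/\ (forall W, unitary W ->
         den (matrix_of alpha beta W) \in unitmx /\ Phi W \is unitarymx),
      (forall W B, unitary W -> B \is unitarymx ->
         (domW alpha beta W = domB alpha beta B <-> B = Phi W)),
      (forall B : 'M[R[i]]_n, B \is unitarymx ->
         exists2 W, unitary W & domW alpha beta W = domB alpha beta B) &
      (forall W1 W2 B, unitary W1 -> unitary W2 -> B \is unitarymx ->
         domW alpha beta W1 = domB alpha beta B ->
         domW alpha beta W2 = domB alpha beta B ->
         forall f, Lplus alpha beta f -> W1 f = W2 f)].
Proof.
move=> unitary num den Phi; rewrite {}/Phi {}/num {}/den.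
(* Both [Gamma_plus] terms become [Gamma_minus] terms, which brings in the form (P M + Q) (Q M +
   P)^-1. *)
rewrite gamma_plus_beta // gamma_plus_alpha //.
split.
- move=> W /(matrix_of_unitary alpha_lt_beta beta_lt_alpha) Mu.
  by split; [exact: Phi_den_unit | exact: Phi_unitary].
- by move=> W B uW _; exact: domW_eq_domB.
(* The matrix (P - B Q)^-1 (B P - Q) solves the linear equation of [Phi_solve] and is unitary, so it
   comes from some [W]. *)
- move=> B Bu; have Mu := Phi_inv_unitary alpha_lt_beta Bu.
  have [W uW WM] := unitary_of_matrix alpha_lt_beta beta_lt_alpha Mu.
  exists W => //; apply/domW_eq_domB => //; rewrite WM; apply/Phi_solve => //.
  by rewrite mulKVmx // Phi_inv_den_unit.
- move=> W1 W2 B u1 u2 Bu.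
  have M1 := matrix_of_unitary alpha_lt_beta beta_lt_alpha u1.
  have M2 := matrix_of_unitary alpha_lt_beta beta_lt_alpha u2.
  move=> /(domW_eq_domB alpha_lt_beta beta_lt_alpha _ u1)/(Phi_solve alpha_lt_beta M1 Bu) E1.
  move=> /(domW_eq_domB alpha_lt_beta beta_lt_alpha _ u2)/(Phi_solve alpha_lt_beta M2 Bu) E2.
  move=> f /(LplusP alpha_lt_beta beta_lt_alpha)[c ->].
  rewrite !unitary_matrixP //; congr (comb _ _ _ _ (_ *m c)).
  (* Both matrices solve the same linear equation, whose left factor P - B Q is invertible. *)
  by apply: (can_inj (mulKmx (Phi_inv_den_unit alpha_lt_beta Bu))); rewrite E1 E2.
Qed.
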